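(* Let $n_1,n_2$ be positive integers, $\mathcal N_1>n_1$, $\mathcal N_2>n_2$, $\mathcal N=\mathcal N_1+\mathcal N_2$, $R_1,R_2>0$ and $K_1,K_2\in\mathbb R$. There exists a constant $\eta=\eta^{\mathcal N_1,\mathcal N_2}$, depending only on $n_i,R_i,\mathcal N_i,K_i$ ($i=1,2$), such that the following holds. Let $(B,g_B,e^{-\Phi}\mathrm{dvol}_{g_B})$ and $(F,g_F,e^{-\Psi}\mathrm{dvol}_{g_F})$ be weighted Riemannian manifolds of dimensions $n_1$ and $n_2$, let $\alpha:F\to(0,\infty)$, $\beta:B\to(0,\infty)$ be smooth, $a=\ln\alpha$, $b=\ln\beta$, and consider the $(R_1,R_2)$-doubly warped product $B\,{}_\alpha^{R_1}\times_\beta^{R_2}F=(B\times F,g,e^{-\chi}\mathrm{dvol}_g)$. Let $(x,p)\in B\times F$, write $\alpha=\alpha(p)$, $\beta=\beta(x)$, and let $\mathcal K^{\mathcal N_1}_B,\mathcal K^{\mathcal N_2}_F\in\mathbb R$. If $${}^B\mathrm{Ric}^{\mathcal N_1}_\Phi\ge(n_1-1)\mathcal K_B^{\mathcal N_1}g_B\ \text{ at }x,\qquad {}^F\mathrm{Ric}^{\mathcal N_2}_\Psi\ge(n_2-1)\mathcal K_F^{\mathcal N_2}g_F\ \text{ at }p,$$ and $$R_2\,{}^B\nabla^2b\le\eta(\nabla\Phi)^2+\eta(\nabla b)^2\ \text{ on }UT_xB,\qquad R_1\,{}^F\nabla^2a\le\eta(\nabla\Psi)^2+\eta(\nabla a)^2\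 \text{ on }UT_pF,$$ then at $(x,p)$ $$\mathrm{Ric}^{\mathcal N}_\chi\ge\min\big\{(n_1-1)\alpha^{-2}\mathcal K^{\mathcal N_1}_B,\ (n_2-1)\beta^{-2}\mathcal K^{\mathcal N_2}_F\big\}\,g.$$
   Context: A weighted Riemannian manifold $(M^n,g,e^{-\Phi}\mathrm{dvol}_g)$ is a complete $n$-dimensional Riemannian manifold with a smooth function $\Phi:M\to\mathbb R$. For $\mathcal N>n$ its $\mathcal N$-Bakry-\'Emery Ricci tensor is $\mathrm{Ric}^{\mathcal N}_\Phi=\mathrm{Ric}+\nabla^2\Phi-(\mathcal N-n)^{-1}\nabla\Phi\otimes\nabla\Phi$. The $(R_1,R_2)$-doubly warped product of $(B^{n_1},g_B,e^{-\Phi}\mathrm{dvol}_{g_B})$ and $(F^{n_2},g_F,e^{-\Psi}\mathrm{dvol}_{g_F})$ with warping functions $\alpha:F\to(0,\infty)$, $\beta:B\to(0,\infty)$ is $B\,{}_\alpha^{R_1}\times_\beta^{R_2}F=(B\times F,\ g=\alpha^2g_B\oplus\beta^2g_F,\ e^{-\chi}\mathrm{dvol}_g)$ with $e^{-\chi}=\alpha^{R_1-n_1}\beta^{R_2-n_2}e^{-\Phi}e^{-\Psi}$, i.e. $\chi=(n_1-R_1)a+(n_2-R_2)b+\Phi+\Psi$ where $a=\ln\alpha$, $b=\ln\beta$. A left superscript $B$ or $F$ means the quantity is computed in $(B,g_B)$ or $(F,g_F)$; without it, it is computed in the product. $UT_xB$ (resp. $UT_pF$) is the set of $g_B$-unit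 vectors in $T_xB$ (resp. $g_F$-unit vectors in $T_pF$). Inequalities between quadratic forms on $UT_xB$ are tested on every $X\in UT_xB$: ${}^B\nabla^2b$ means ${}^B\nabla^2b(X,X)$, $(\nabla b)^2$ means $(\nabla_Xb)^2$ and $(\nabla\Phi)^2$ means $(\nabla_X\Phi)^2$; similarly on $UT_pF$. *)

(* Defs.v *)
From HB Require Import structures.
From mathcomp Require Import all_boot all_order all_algebra.
From mathcomp Require Import all_classical all_reals all_analysis.

Set Implicit Arguments.
Unset Strict Implicit.
Unset Printing Implicit Defensive.

Import Order.TTheory GRing.Theory Num.Theory.
Import numFieldNormedType.Exports.

Local Open Scope classical_set_scope.
Local Open Scope ring_scope.

Section Local.
Context {R : realType} {n : nat}.
Implicit Types (f : 'rV[R]_n -> R) (g : 'rV[R]_n -> 'M[R]_n) (u : 'rV[R]_n).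

Definition partial (k : 'I_n) f : 'rV[R]_n -> R :=
  fun u => 'D_('e_k) f u.

Definition grad f u : 'rV[R]_n := \row_k partial k f u.

(* C^oo on U: all iterated partial derivatives exist and are (Frechet)
   differentiable, hence continuous, at the points of U. *)
Definition smooth_on (U : set 'rV[R]_n) f : Prop :=
  forall (s : seq 'I_n) u, U u -> differentiable (foldr partial f s) u.

Definition quad (A : 'M[R]_n) (v : 'rV[R]_n) : R := (v *m A *m v^T) 0 0.

(* Gamma^k_{ij} in the argument order k, i, j. *)
Definition christoffel g (k i j : 'I_n) u : R :=
  2^-1 * \sum_l invmx (g u) k l *
    (partial i (fun w => g w j l) u + partial j (fun w => g w i l) u
     - partial l (fun w => g w i j) u).

(* dx^l (R(d_i, d_j) d_k), where
   R(X, Y) Z = D_X D_Y Z - D_Y D_X Z - D_[X, Y] Z. *)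
Definition riemann g (l k i j : 'I_n) u : R :=
  partial i (christoffel g l j k) u - partial j (christoffel g l i k) u
  + \sum_m (christoffel g l i m u * christoffel g m j k u
            - christoffel g l j m u * christoffel g m i k u).

(* Ric(Y, Z) = tr (X |-> R(X, Y) Z); positive on round spheres. *)
Definition ricci g u : 'M[R]_n := \matrix_(j, k) \sum_i riemann g i k i j u.

Definition hessian g f u : 'M[R]_n :=
  \matrix_(i, j) (partial i (partial j f) u
                  - \sum_k christoffel g k i j u * partial k f u).

Definition bakry_emery (N : R) g f u : 'M[R]_n :=
  ricci g u + hessian g f u
  - (N - n%:R)^-1 *: ((grad f u)^T *m grad f u).

End Local.

Record chart (R : realType) (n : nat) (M : topologicalType) := Chart {
  dom : set M;
  coord : M -> 'rV[R]_n;
  param : 'rV[R]_n -> M;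
}.

Definition cod R n M (c : @chart R n M) : set 'rV[R]_n := coord c @` dom c.

Definition is_chart R n M (c : @chart R n M) : Prop :=
  [/\ open (dom c), open (cod c),
      (forall x, dom c x -> param c (coord c x) = x),
      {within dom c, continuous (coord c)} &
      {within cod c, continuous (param c)}].

(* The data (M, g, e^{-potential} dvol_g): an indexed atlas of M, the matrix
   (g_{ij}) in each chart of the atlas, and the weight.  Values of [coord c]
   outside [dom c], and of [param c] and [metric c] outside [cod c], are
   irrelevant. *)
Record wmfd (R : realType) (n : nat) := WMfd {
  carrier :> topologicalType;
  index : Type;
  atlas : index -> chart R n carrier;
  metric : index -> 'rV[R]_n -> 'M[R]_n;
  potential : carrier -> R;
}.

Arguments potential {R n} w _ : rename.

Section Manifold.
Context {R : realType} {n : nat} (M : wmfd R n).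
Implicit Types (c d : index M) (x : M) (f : M -> R).

Definition transition c d : 'rV[R]_n -> 'rV[R]_n :=
  coord (atlas d) \o param (atlas c).

Definition is_smooth_manifold : Prop :=
  [/\ hausdorff_space M, @second_countable M,
      (forall c, is_chart (atlas c)),
      (forall x, exists c, dom (atlas c) x) &
      forall c d (k : 'I_n),
        smooth_on (coord (atlas c) @` (dom (atlas c) `&` dom (atlas d)))
          (fun u => transition c d u 0 k)].

Definition smooth_fun f : Prop :=
  forall c, smooth_on (cod (atlas c)) (f \o param (atlas c)).

(* [jacobian] acts on row vectors from the right, so the last clause says that
   g_c (v, v) = g_d (dt v, dt v) with t the transition map from c to d. *)
Definition is_riemannian_metric : Prop :=
  [/\ (forall c (i j : 'I_n),
         smooth_on (cod (atlas c)) (fun u => metric c u i j)),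
      (forall c u, cod (atlas c) u -> (metric c u)^T = metric c u),
      (forall c u v, cod (atlas c) u -> v != 0 -> 0 < quad (metric c u) v) &
      forall c d x, dom (atlas c) x -> dom (atlas d) x ->
        let u := coord (atlas c) x in
        let J := jacobian (transition c d) u in
        metric c u = J *m metric d (coord (atlas d) x) *m J^T].

Definition coord_curve c (gamma : R -> M) (k : 'I_n) : R -> R :=
  fun t => coord (atlas c) (gamma t) 0 k.

Definition is_geodesic (gamma : R -> M) : Prop :=
  continuous gamma /\
  forall c t, dom (atlas c) (gamma t) -> forall k : 'I_n,
    [/\ derivable (coord_curve c gamma k) t 1,
        derivable (derive1 (coord_curve c gamma k)) t 1 &
        derive1 (derive1 (coord_curve c gamma k)) t
        + \sum_i \sum_j
            christoffel (metric c) k i j (coord (atlas c) (gamma t))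
            * derive1 (coord_curve c gamma i) t
            * derive1 (coord_curve c gamma j) t
        = 0].

(* Geodesic completeness: exp_x is defined on the whole of T_xM. *)
Definition is_complete : Prop :=
  forall c x (v : 'rV[R]_n), dom (atlas c) x ->
    exists gamma : R -> M,
      [/\ is_geodesic gamma, gamma 0 = x &
          forall k, derive1 (coord_curve c gamma k) 0 = v 0 k].

Definition is_weighted_riemannian_manifold : Prop :=
  [/\ is_smooth_manifold, is_riemannian_metric, is_complete &
      smooth_fun (potential M)].

(* Tensors at the point x, evaluated on the tangent vector whose components in
   the chart c are v. *)

Definition metric_at c x v : R := quad (metric c (coord (atlas c) x)) v.

Definition deriv_at c f x v : R :=
  'D_v (f \o param (atlas c)) (coord (atlas c) x).

Definition hessian_at c f x v : R :=
  quad (hessian (metric c) (f \o param (atlas c)) (coord (atlas c) x)) v.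

Definition ric_at (N : R) c x v : R :=
  quad (bakry_emery N (metric c) (potential M \o param (atlas c))
          (coord (atlas c) x)) v.

Definition unit_tangent c x : set 'rV[R]_n := [set v | metric_at c x v = 1].

Definition ric_ge (N kappa : R) x : Prop :=
  forall c, dom (atlas c) x ->
    forall v, kappa * metric_at c x v <= ric_at N c x v.

End Manifold.

Definition prod_chart (R : realType) (n1 n2 : nat) (B F : topologicalType)
    (c : chart R n1 B) (d : chart R n2 F) : chart R (n1 + n2) (B * F)%type :=
  Chart (dom c `*` dom d)
    (fun z => row_mx (coord c z.1) (coord d z.2))
    (fun u => (param c (lsubmx u), param d (rsubmx u))).

(* (B x F, alpha^2 g_B (+) beta^2 g_F, e^{-chi} dvol), with the atlas of products
   of charts of B and F, and with
   e^{-chi} = alpha^(R1 - n1) beta^(R2 - n2) e^{-Phi} e^{-Psi}. *)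
Definition doubly_warped_product (R : realType) (n1 n2 : nat) (R1 R2 : R)
    (B : wmfd R n1) (F : wmfd R n2) (alpha : F -> R) (beta : B -> R) :
    wmfd R (n1 + n2) :=
  {| carrier := (B * F)%type;
     index := (index B * index F)%type;
     atlas := fun cd => prod_chart (atlas cd.1) (atlas cd.2);
     metric := fun cd u =>
       block_mx
         (alpha (param (atlas cd.2) (rsubmx u)) ^+ 2 *: metric cd.1 (lsubmx u)) 0
         0 (beta (param (atlas cd.1) (lsubmx u)) ^+ 2 *: metric cd.2 (rsubmx u));
     potential := fun z =>
       (n1%:R - R1) * ln (alpha z.2) + (n2%:R - R2) * ln (beta z.1)
       + potential B z.1 + potential F z.2 |}.

Lemma expR_potential_dwp (R : realType) (n1 n2 : nat) (R1 R2 : R)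
    (B : wmfd R n1) (F : wmfd R n2) (alpha : F -> R) (beta : B -> R) (z : B * F) :
  0 < alpha z.2 -> 0 < beta z.1 ->
  expR (- potential (doubly_warped_product R1 R2 alpha beta) z) =
  alpha z.2 `^ (R1 - n1%:R) * beta z.1 `^ (R2 - n2%:R)
  * expR (- potential B z.1) * expR (- potential F z.2).
Proof.
move=> a0 b0; rewrite /powR !gt_eqF// -!expRD /=.
by congr expR; rewrite !opprD -!mulNr !opprB.
Qed.

(* Main.v *)
(* In a product chart the metric alpha^2 g_B (+) beta^2 g_F is block diagonal, and
   its Christoffel symbols and Ricci tensor are explicit.  For X tangent to B and
   V tangent to F, with a = ln alpha and b = ln beta,
     (Ric + Hess chi)(X, X) = (Ric_B + Hess Phi - R2 Hess b)(X, X) - n2 (Xb)^2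
       - (alpha / beta)^2 |X|^2 tr_F (Hess a + R1 da^2 - da dPsi),
     (Ric + Hess chi)(X, V) = (R1 + R2 - 2) (Xb)(Va) - (XPhi)(Va) - (Xb)(VPsi),
   and symmetrically on F.  The hypothesis on Hess a makes the form under the
   trace nonpositive once -eta >= R1^2 + R1, so the trace has the right sign; and
   - R2 Hess b(X, X) >= - eta ((XPhi)^2 + (Xb)^2), its analogue on F included,
   absorbs every remaining quadratic expression in XPhi, Xb, VPsi, Va, among them
   the square of d chi, when - eta is large. *)

Require Import Defs.
From HB Require Import structures.
From mathcomp Require Import all_boot all_order all_algebra.
From mathcomp Require Import all_classical all_reals all_analysis.
From mathcomp Require Import ring lra.

Import Order.TTheory GRing.Theory Num.Theory.
Import numFieldNormedType.Exports.

Local Open Scope classical_set_scope.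
Local Open Scope ring_scope.

Set Implicit Arguments.
Unset Strict Implicit.
Unset Printing Implicit Defensive.

(** * Partial derivatives *)

Section Calculus.
Context {R : realType} {n : nat}.
Implicit Types (f h : 'rV[R]_n -> R) (u : 'rV[R]_n) (k : 'I_n).

Lemma partial_near k f h u :
  (\forall w \near u, f w = h w) -> partial k f u = partial k h u.
Proof. exact: near_eq_derive. Qed.

Lemma partial_cst k (c : R) u : partial k (fun _ => c) u = 0.
Proof. exact: derive_cst. Qed.

Lemma partialD k f h u : derivable f u 'e_k -> derivable h u 'e_k ->
  partial k (fun w => f w + h w) u = partial k f u + partial k h u.
Proof. exact: deriveD. Qed.

Lemma partialM k f h u : derivable f u 'e_k -> derivable h u 'e_k ->
  partial k (fun w => f w * h w) u = f u * partial k h u + h u * partial k f u.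
Proof. exact: deriveM. Qed.

Lemma partialZ k (c : R) f u : derivable f u 'e_k ->
  partial k (fun w => c * f w) u = c * partial k f u.
Proof. exact: deriveZ. Qed.

Lemma partialZr k (c : R) f u : derivable f u 'e_k ->
  partial k (fun w => f w * c) u = partial k f u * c.
Proof.
by move=> df; under [fun w => _]funext => w do rewrite mulrC; rewrite partialZ// mulrC.
Qed.

Lemma derivable_bigsum m (f : 'I_m -> 'rV[R]_n -> R) u v :
  (forall i, derivable (f i) u v) -> derivable (fun w => \sum_i f i w) u v.
Proof.
move=> df; rewrite (_ : (fun w => _) = \sum_(i < m) f i).
  exact: derivable_sum.
by apply/funext => w; rewrite fct_sumE.
Qed.

Lemma partial_sum k m (f : 'I_m -> 'rV[R]_n -> R) u :
  (forall i, derivable (f i) u 'e_k) ->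
  partial k (fun w => \sum_i f i w) u = \sum_i partial k (f i) u.
Proof.
move=> df; rewrite /partial.
rewrite (_ : (fun w => _) = \sum_(i < m) f i); first exact: derive_sum.
by apply/funext => w; rewrite fct_sumE.
Qed.

Lemma differentiable_bigprod (T : Type) (s : seq T) (f : T -> 'rV[R]_n -> R) u :
  (forall i, differentiable (f i) u) ->
  differentiable (fun w => \prod_(i <- s) f i w) u.
Proof.
move=> df; elim: s => [|i s IH].
  by under [fun w => _]funext => w do rewrite big_nil; exact: differentiable_cst.
by under [fun w => _]funext => w do rewrite big_cons; exact: differentiableM.
Qed.

Lemma differentiable_bigsum (T : Type) (s : seq T) (f : T -> 'rV[R]_n -> R) u :
  (forall i, differentiable (f i) u) ->
  differentiable (fun w => \sum_(i <- s) f i w) u.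
Proof.
move=> df; elim: s => [|i s IH].
  by under [fun w => _]funext => w do rewrite big_nil; exact: differentiable_cst.
by under [fun w => _]funext => w do rewrite big_cons; exact: differentiableD.
Qed.

Lemma differentiable_det m (A : 'rV[R]_n -> 'M[R]_m) u :
  (forall i j, differentiable (fun w => A w i j) u) ->
  differentiable (fun w => \det (A w)) u.
Proof.
move=> dA; apply: differentiable_bigsum => s.
apply: differentiableM; first exact: differentiable_cst.
exact: differentiable_bigprod.
Qed.

(** Cramer's rule: where the determinant is a unit, each entry of the inverse is a cofactor over the
    determinant. Invertibility is required near [u] because [invmx] returns a singular matrix
    unchanged. *)
Lemma derivable_invmx m (A : 'rV[R]_n -> 'M[R]_m) u v (i j : 'I_m) :
  (forall i j, differentiable (fun w => A w i j) u) ->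
  (\forall w \near u, A w \in unitmx) ->
  derivable (fun w => invmx (A w) i j) u v.
Proof.
move=> dA nA; have uA := nbhs_singleton nA.
apply: (@near_eq_derivable _ _ _ (fun w => (\det (A w))^-1 * (\adj (A w)) i j)).
  by apply: filterS nA => w uw; rewrite /invmx uw [RHS]mxE.
apply: diff_derivable; apply: differentiableM.
  apply: differentiableV; first exact: differentiable_det.
  by move: uA; rewrite unitmxE unitfE.
under [fun w => _]funext => w do rewrite mxE /cofactor.
apply: differentiableM; first exact: differentiable_cst.
apply: differentiable_det => a b.
by under [fun w => _]funext => w do rewrite !mxE; exact: dA.
Qed.

Lemma deriveE_grad f u v : differentiable f u ->
  'D_v f u = (grad f u *m v^T) 0 0.
Proof.
move=> df; rewrite deriveE// [in LHS](row_sum_delta v) linear_sum mxE.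
by apply: eq_bigr => k _; rewrite linearZ/= -deriveE// !mxE mulrC.
Qed.

End Calculus.

(** * Quadratic forms *)

Section QuadraticForms.
Context {R : realType}.

Lemma quadD n (A B : 'M[R]_n) v : quad (A + B) v = quad A v + quad B v.
Proof. by rewrite /quad mulmxDr mulmxDl mxE. Qed.

Lemma quadZ n c (A : 'M[R]_n) v : quad (c *: A) v = c * quad A v.
Proof. by rewrite /quad -scalemxAr -scalemxAl mxE. Qed.

Lemma quadN n (A : 'M[R]_n) v : quad (- A) v = - quad A v.
Proof. by rewrite -scaleN1r quadZ mulN1r. Qed.

Lemma quad_scale n c (A : 'M[R]_n) v : quad A (c *: v) = c ^+ 2 * quad A v.
Proof. by rewrite /quad -!scalemxAl linearZ/= -scalemxAr !mxE mulrA -expr2. Qed.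

Lemma mul_outer m n (r v : 'rV[R]_m) (s w : 'rV[R]_n) :
  (v *m (r^T *m s) *m w^T) 0 0 = (r *m v^T) 0 0 * (s *m w^T) 0 0.
Proof.
rewrite mulmxA -(mulmxA (v *m r^T)) mxE big_ord1; congr (_ * _).
by rewrite -[in RHS](trmxK r) -trmx_mul [RHS]mxE.
Qed.

Lemma quad_outer n (r s : 'rV[R]_n) v :
  quad (r^T *m s) v = (r *m v^T) 0 0 * (s *m v^T) 0 0.
Proof. exact: mul_outer. Qed.

Lemma quad_block n1 n2 A B C D (v : 'rV[R]_n1) (w : 'rV[R]_n2) :
  quad (block_mx A B C D) (row_mx v w) =
  quad A v + (v *m B *m w^T) 0 0 + (w *m C *m v^T) 0 0 + quad D w.
Proof.
rewrite /quad mul_row_block tr_row_mx mul_row_col !mulmxDl !mxE.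
by rewrite -!addrA; congr (_ + _); rewrite addrCA.
Qed.

Definition posdef n (A : 'M[R]_n) := forall v, v != 0 -> 0 < quad A v.

(** A row [v] of the kernel has [v *m A = 0], so its quadratic form vanishes and definiteness forces
    [v = 0]. *)
Lemma posdef_unit n (A : 'M[R]_n) : posdef A -> A \in unitmx.
Proof.
move=> pA; rewrite -row_free_unit -kermx_eq0; apply/eqP/row_matrixP => i.
rewrite row0; apply/eqP; apply: contraT => /pA.
by rewrite /quad -row_mul mulmx_ker row0 mul0mx mxE ltxx.
Qed.

(** The form of the inverse at [v] is the form of [A] at [v *m invmx A]. *)
Lemma posdef_inv n (A : 'M[R]_n) : A^T = A -> posdef A -> posdef (invmx A).
Proof.
move=> sA pA v v0; have uA := posdef_unit pA.
have /pA : v *m invmx A != 0.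
  by apply: contraNneq v0 => e; rewrite -(mulmxKV uA v) e mul0mx.
by rewrite /quad trmx_mul trmx_inv sA mulmxKV // mulmxA.
Qed.

Lemma posdef_gram n (A : 'M[R]_n) : A^T = A -> posdef A ->
  exists W : 'M[R]_n, A = W^T *m W.
Proof.
(* Cholesky: eliminate the first row and recurse on the Schur complement. *)
elim: n A => [|n IH] A sA pA.
  by exists 0; apply/matrixP => -[].
move: A sA pA; rewrite -[n.+1]/(1 + n)%N => A.
rewrite -(submxK A) tr_block_mx; set g := ulsubmx A; set r := ursubmx A.
set D := drsubmx A => /eq_block_mx [sg _ rE sD] pA.
rewrite -rE; rewrite -rE in pA.
pose c := g 0 0.
have gE : g = c%:M by rewrite [LHS]mx11_scalar.
have c0 : 0 < c.
  have /pA : row_mx (1 : 'rV[R]_1) (0 : 'rV[R]_n) != 0.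
    apply/eqP => /(congr1 lsubmx); rewrite row_mxKl linear0 => /eqP.
    by rewrite oner_eq0.
  rewrite quad_block /quad !mul0mx trmx0 !mulmx0 gE mul1mx trmx1 mulmx1.
  by rewrite !mxE !addr0 mulr1n.
have [W' W'E] : exists W' : 'M[R]_n, D - c^-1 *: (r^T *m r) = W'^T *m W'.
  apply: IH; first by rewrite linearB linearZ/= trmx_mul trmxK sD.
  move=> v v0.
  (* For fixed [v] this first coordinate minimises the form of [A]; the minimum is the form of the
     Schur complement at [v]. *)
  have /pA : row_mx (- c^-1 *: (v *m r^T)) v != 0.
    by apply/eqP => /(congr1 rsubmx); rewrite row_mxKr linear0; apply/eqP.
  rewrite quad_block quad_scale quadD quadN quadZ quad_outer /quad gE.
  pose s := (r *m v^T) 0 0.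
  have sE : v *m r^T = s%:M.
    by rewrite [LHS]mx11_scalar -[v *m r^T]trmxK trmx_mul trmxK mxE.
  have sE' : r *m v^T = s%:M by rewrite [LHS]mx11_scalar.
  rewrite linearZ/= sE -!scalemxAl -!scalemxAr tr_scalar_mx -(mulmxA s%:M r) sE'.
  rewrite -!scalar_mxM !mxE !mulr1n.
  rewrite -/s; set t := \sum_j _; have c_neq0 := lt0r_neq0 c0.
  by congr (_ < _); field.
exists (block_mx (Num.sqrt c)%:M ((Num.sqrt c)^-1 *: r) 0 W').
have sc : Num.sqrt c != 0 by rewrite sqrtr_eq0 -ltNge.
rewrite tr_block_mx mulmx_block !trmx0 !mul0mx !mulmx0 !addr0 -W'E.
rewrite tr_scalar_mx -scalar_mxM -expr2 sqr_sqrtr ?ltW// gE.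
rewrite !mul_scalar_mx scalerA divff// scale1r linearZ/= mul_mx_scalar scalerA.
rewrite divff// scale1r.
rewrite -scalemxAl -scalemxAr scalerA -invfM -expr2 sqr_sqrtr ?ltW//.
by rewrite addrC subrK.
Qed.

(** With the inverse of [A] written as [W^T *m W], the trace is the sum of the values of the form of
    [S] on the rows of [W]. Only this form enters, which suits the nonsymmetric term da dPsi. *)
Lemma mxtrace_inv_posdef_le0 n (A S : 'M[R]_n) :
  A^T = A -> posdef A -> (forall v, quad S v <= 0) -> \tr (invmx A *m S) <= 0.
Proof.
move=> sA pA S0.
have sV : (invmx A)^T = invmx A by rewrite trmx_inv sA.
have [W ->] := posdef_gram sV (posdef_inv sA pA).
rewrite -mulmxA mxtrace_mulC; apply: sumr_le0 => i _.
suff -> : (W *m S *m W^T) i i = quad S (row i W) by exact: S0.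
rewrite /quad -row_mul tr_row [LHS]mxE [RHS]mxE.
by apply: eq_bigr => j _; rewrite [in RHS]mxE [col _ _ _ _]mxE.
Qed.

End QuadraticForms.

(** * Metrics in a chart *)

(** One derivative of the entries is recorded: second derivatives of a factor metric occur inside
    derivatives of its own Christoffel symbols, which are carried along unexpanded. *)
Record local_metric (R : realType) (n : nat) (U : set 'rV[R]_n)
    (g : 'rV[R]_n -> 'M[R]_n) : Prop := LocalMetric {
  local_open : open U;
  local_diff : forall u i j, U u -> differentiable (fun w => g w i j) u;
  local_sym : forall u, U u -> (g u)^T = g u;
  local_posdef : forall u, U u -> posdef (g u) }.

(** Components of the gradient vector of [f], that is of df with its index raised by [g]; [grad] is
    the covector df itself. *)
Definition sharp (R : realType) (n : nat) (g : 'rV[R]_n -> 'M[R]_n)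
    (f : 'rV[R]_n -> R) (k : 'I_n) : 'rV[R]_n -> R :=
  fun u => \sum_l invmx (g u) k l * partial l f u.

Section LocalMetric.
Context {R : realType} {n : nat} {U : set 'rV[R]_n} {g : 'rV[R]_n -> 'M[R]_n}.
Context (gU : local_metric U g).
Implicit Types (u : 'rV[R]_n) (i j k l m : 'I_n).

Lemma local_near u : U u -> \forall w \near u, U w.
Proof. by move=> Uu; apply: open_nbhs_nbhs; split=> //; exact: local_open gU. Qed.

Lemma local_unit u : U u -> g u \in unitmx.
Proof. by move=> Uu; apply: posdef_unit; exact: local_posdef gU _ Uu. Qed.

Lemma local_symE u i j : U u -> g u i j = g u j i.
Proof. by move=> Uu; rewrite -[in LHS](local_sym gU Uu) mxE. Qed.

Lemma local_inv_sym u i j : U u -> invmx (g u) i j = invmx (g u) j i.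
Proof. by move=> Uu; rewrite -[in LHS](local_sym gU Uu) -trmx_inv mxE. Qed.

Lemma local_mulVE u i j : U u ->
  \sum_l invmx (g u) i l * g u l j = (i == j)%:R.
Proof.
move=> Uu; have /matrixP/(_ i j) := mulVmx (local_unit Uu).
by rewrite !mxE.
Qed.

Lemma partial_metric_sym u k i j : U u ->
  partial k (fun w => g w i j) u = partial k (fun w => g w j i) u.
Proof.
move=> Uu; apply: partial_near; apply: filterS (local_near Uu) => w Uw.
exact: local_symE.
Qed.

Lemma derivable_metric_inv u v i j : U u -> derivable (fun w => invmx (g w) i j) u v.
Proof.
move=> Uu; apply: derivable_invmx => [a b|]; first exact: local_diff gU _ _ _ Uu.
by apply: filterS (local_near Uu) => w; exact: local_unit.
Qed.

Lemma christoffelC u k i j : U u -> christoffel g k i j u = christoffel g k j i u.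
Proof.
move=> Uu; congr (_ * _); apply: eq_bigr => l _; congr (_ * _).
by rewrite (partial_metric_sym _ i j)// [X in X - _]addrC.
Qed.

(** Lowering the upper index cancels the inverse metric and leaves the Christoffel symbols of the
    first kind. *)
Lemma lower_christoffel u k i j : U u ->
  \sum_r g u k r * christoffel g r i j u =
  2^-1 * (partial i (fun w => g w j k) u + partial j (fun w => g w i k) u
          - partial k (fun w => g w i j) u).
Proof.
move=> Uu; set d := fun l => partial i (fun w => g w j l) u +
  partial j (fun w => g w i l) u - partial l (fun w => g w i j) u.
rewrite -[in RHS]/(d k).
pose c := \col_l d l.
have -> : \sum_r g u k r * christoffel g r i j u
    = (g u *m (2^-1 *: (invmx (g u) *m c))) k 0.
  rewrite mxE; apply: eq_bigr => r _; rewrite !mxE; congr (_ * (_ * _)).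
  by apply: eq_bigr => l _; rewrite mxE.
by rewrite -scalemxAr mulKVmx ?local_unit// !mxE.
Qed.

(** Metric compatibility: in the sum of two symbols of the first kind, the derivatives in directions
    [i] and [j] cancel and the one in direction [k] is counted twice. *)
Lemma partial_metric u k i j : U u ->
  partial k (fun w => g w i j) u =
  \sum_r christoffel g r k i u * g u r j + \sum_r g u i r * christoffel g r k j u.
Proof.
move=> Uu; rewrite lower_christoffel//.
under eq_bigr => r _ do rewrite mulrC local_symE//.
rewrite lower_christoffel// (partial_metric_sym k j i)//.
rewrite (partial_metric_sym i k j)//.
rewrite [RHS](_ : _ = 2^-1 * (2 * partial k (fun w => g w i j) u)); last by ring.
by rewrite mulKf.
Qed.

(** The inverse metric is parallel too; [divergence_sharp] uses this to differentiate a raised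
    gradient. *)
Lemma partial_metric_inv u k i j : U u ->
  partial k (fun w => invmx (g w) i j) u =
  - (\sum_m christoffel g i k m u * invmx (g u) m j
     + \sum_m christoffel g j k m u * invmx (g u) i m).
Proof.
move=> Uu.
pose D := \matrix_(a, b) partial k (fun w => invmx (g w) a b) u.
pose dG := \matrix_(a, b) partial k (fun w => g w a b) u.
pose C := \matrix_(r, m) christoffel g r k m u.
have dGE : dG = C^T *m g u + g u *m C.
  apply/matrixP => a b; rewrite !mxE partial_metric//.
  by congr (_ + _); apply: eq_bigr => r _; rewrite !mxE.
(* Differentiate g^-1 g = 1. *)
have DE : D *m g u + invmx (g u) *m dG = 0.
  apply/matrixP => a b; rewrite !mxE -big_split/=.
  have := partial_cst k ((a == b)%:R : R) u.
  rewrite -(@partial_near _ _ _ (fun w => \sum_l invmx (g w) a l * g w l b)); last first.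
    by apply: filterS (local_near Uu) => w Uw; rewrite local_mulVE.
  rewrite partial_sum => [e|l].
    rewrite -[RHS]e; apply: eq_bigr => l _; rewrite partialM; last 2 first.
    - exact: derivable_metric_inv.
    - by apply: diff_derivable; exact: local_diff gU _ _ _ Uu.
    by rewrite !mxE addrC; congr (_ + _); rewrite mulrC.
  apply: derivableM; first exact: derivable_metric_inv.
  by apply: diff_derivable; exact: local_diff gU _ _ _ Uu.
have {}DE : D = - (C *m invmx (g u) + invmx (g u) *m C^T).
  have uu := local_unit Uu.
  rewrite -[D](mulmxK uu) (eqP (_ : D *m g u == - (invmx (g u) *m dG))).
    rewrite dGE mulmxDr mulmxA mulKmx// mulNmx mulmxDl addrC; congr (- (_ + _)).
    by rewrite mulmxK.
  by rewrite -addr_eq0 DE.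
have /matrixP/(_ i j) := DE; rewrite !mxE => ->; congr (- (_ + _)).
  by apply: eq_bigr => m _; rewrite !mxE.
by apply: eq_bigr => m _; rewrite !mxE mulrC.
Qed.

(** The divergence of the gradient is the Laplacian. Of the two Christoffel sums produced by
    differentiating the inverse metric, one cancels the connection term of the divergence and the
    other is the connection term of the Hessian. *)
Lemma divergence_sharp u (f : 'rV[R]_n -> R) : U u ->
  (forall k l, derivable (partial l f) u 'e_k) ->
  \sum_k partial k (sharp g f k) u
  + \sum_m (\sum_k christoffel g k k m u) * sharp g f m u =
  \tr (invmx (g u) *m hessian g f u).
Proof.
move=> Uu df.
have -> : \sum_k partial k (sharp g f k) u =
    \sum_k \sum_l (invmx (g u) k l * partial k (partial l f) u
    + partial l f u * partial k (fun w => invmx (g w) k l) u).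
  apply: eq_bigr => k _; rewrite partial_sum => [|l].
    by apply: eq_bigr => l _; rewrite partialM//; exact: derivable_metric_inv.
  by apply: derivableM => //; exact: derivable_metric_inv.
have -> : \tr (invmx (g u) *m hessian g f u) =
    \sum_k \sum_l (invmx (g u) k l * partial k (partial l f) u
     - invmx (g u) k l * \sum_m christoffel g m k l u * partial m f u).
  rewrite /mxtrace; under eq_bigr => k _ do rewrite mxE.
  rewrite exchange_big; apply: eq_bigr => k _; apply: eq_bigr => l _.
  by rewrite mxE mulrBr (local_inv_sym l).
under eq_bigr => k _ do rewrite big_split/=.
under [RHS]eq_bigr => k _ do rewrite sumrB.
rewrite big_split/= sumrB -addrA; congr (_ + _).
under eq_bigr => k _ do under eq_bigr => l _ do
  rewrite partial_metric_inv// mulrN mulrDr opprD.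
under eq_bigr => k _ do rewrite big_split/= !sumrN.
rewrite big_split/= !sumrN [X in - X - _ + _](_ : _ =
   \sum_m (\sum_k christoffel g k k m u) * sharp g f m u).
  rewrite [X in _ = - X](_ : _ = \sum_k \sum_l partial l f u *
      (\sum_m christoffel g l k m u * invmx (g u) k m)).
    by rewrite addrAC addNr add0r.
  apply: eq_bigr => k _; under [RHS]eq_bigr => l _ do rewrite mulr_sumr.
  rewrite [RHS]exchange_big; apply: eq_bigr => l _; rewrite mulr_sumr.
  by apply: eq_bigr => m _; ring.
under [RHS]eq_bigr => m _ do rewrite mulr_suml.
rewrite [RHS]exchange_big; apply: eq_bigr => k _.
under eq_bigr => l _ do rewrite mulr_sumr.
rewrite exchange_big; apply: eq_bigr => m _; rewrite mulr_sumr.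
by apply: eq_bigr => l _; ring.
Qed.

End LocalMetric.

(** * Christoffel symbols of a doubly warped metric *)

(** Positivity is asked at every coordinate vector: outside the range of the chart, [param] still
    yields points of the manifold, where the warping function is positive. *)
Record local_warping (R : realType) (n : nat) (U : set 'rV[R]_n)
    (al : 'rV[R]_n -> R) : Prop := LocalWarping {
  warping_gt0 : forall u, 0 < al u;
  warping_diff : forall u, U u -> differentiable al u;
  warping_diff2 : forall u k, U u -> differentiable (partial k al) u }.

Definition log (R : realType) (n : nat) (al : 'rV[R]_n -> R) : 'rV[R]_n -> R :=
  fun u => ln (al u).

(** * Logarithm of a warping function *)

Section LocalWarping.
Context {R : realType} {n : nat} {U : set 'rV[R]_n} {al : 'rV[R]_n -> R}.
Context (oU : open U).
Context (alU : local_warping U al).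
Implicit Types (u : 'rV[R]_n) (k l : 'I_n).

Lemma differentiable_log u : U u -> differentiable (log al) u.
Proof.
move=> Uu; apply: differentiable_comp; first exact: (warping_diff alU).
apply/derivable1_diffP; apply: ex_derive; apply: is_derive1_ln.
exact: warping_gt0 alU _.
Qed.

Lemma partial_log u k : U u -> partial k (log al) u = (al u)^-1 * partial k al u.
Proof.
move=> Uu; have du := warping_diff alU Uu.
have a0 := warping_gt0 alU u.
have dl : derivable (@ln R) (al u) 1 by apply: ex_derive; exact: is_derive1_ln.
rewrite /partial !deriveE//; last exact: differentiable_log.
rewrite diff_comp//; last exact/derivable1_diffP.
rewrite /= deriv1E// derive1E.
by have [_ ->] := is_derive1_ln a0; rewrite /GRing.scale/= mulrC.
Qed.

Lemma partial_sqr_warping u k : U u ->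
  partial k (fun w => al w ^+ 2) u = 2 * al u ^+ 2 * partial k (log al) u.
Proof.
move=> Uu; have du : derivable al u 'e_k.
  by apply: diff_derivable; exact: (warping_diff alU).
rewrite partialM// partial_log//.
by have := warping_gt0 alU u => /lt0r_neq0; move: (partial _ _ _) => d a0; field.
Qed.

Lemma derivable_sqr_warping u v : U u -> derivable (fun w => al w ^+ 2) u v.
Proof.
by move=> Uu; apply: derivableM; apply: diff_derivable; exact: (warping_diff alU).
Qed.

Lemma derivable_partial_log u k v : U u -> derivable (partial k (log al)) u v.
Proof.
move=> Uu; apply: (@near_eq_derivable _ _ _ (fun w => (al w)^-1 * partial k al w)).
  have : \forall w \near u, U w by exact: open_nbhs_nbhs.
  by apply: filterS => w Uw; rewrite partial_log.
apply: derivableM; apply: diff_derivable; last exact: (warping_diff2 alU).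
apply: differentiableV; first exact: (warping_diff alU).
exact: lt0r_neq0 (warping_gt0 alU u).
Qed.

End LocalWarping.

(* Only these facts about [row_mx], [lshift], [rshift] and the metric matter, and
   they are invariant under exchanging the factors. *)
Record warped_metric (R : realType) (n1 n2 n : nat)
    (U1 : set 'rV[R]_n1) (U2 : set 'rV[R]_n2)
    (g1 : 'rV[R]_n1 -> 'M[R]_n1) (g2 : 'rV[R]_n2 -> 'M[R]_n2)
    (al : 'rV[R]_n2 -> R) (be : 'rV[R]_n1 -> R)
    (i1 : 'I_n1 -> 'I_n) (i2 : 'I_n2 -> 'I_n)
    (pt : 'rV[R]_n1 -> 'rV[R]_n2 -> 'rV[R]_n)
    (g : 'rV[R]_n -> 'M[R]_n) : Prop := WarpedMetric {
  wm_metric1 : local_metric U1 g1;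
  wm_metric2 : local_metric U2 g2;
  wm_warping1 : local_warping U2 al;
  wm_warping2 : local_warping U1 be;
  wm_sum : forall F : 'I_n -> R, \sum_i F i = \sum_i F (i1 i) + \sum_i F (i2 i);
  wm_slice1 : forall w q i h,
    pt (h *: 'e_i + w) q = h *: 'e_(i1 i) + pt w q;
  wm_slice2 : forall w q i h,
    pt w (h *: 'e_i + q) = h *: 'e_(i2 i) + pt w q;
  wm_entry11 : forall w q i j, g (pt w q) (i1 i) (i1 j) = al q ^+ 2 * g1 w i j;
  wm_entry12 : forall w q i j, g (pt w q) (i1 i) (i2 j) = 0;
  wm_entry21 : forall w q i j, g (pt w q) (i2 i) (i1 j) = 0;
  wm_entry22 : forall w q i j, g (pt w q) (i2 i) (i2 j) = be w ^+ 2 * g2 q i j;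
  wm_inv11 : forall w q i j, U1 w -> U2 q ->
    invmx (g (pt w q)) (i1 i) (i1 j) = al q ^- 2 * invmx (g1 w) i j;
  wm_inv12 : forall w q i j, U1 w -> U2 q ->
    invmx (g (pt w q)) (i1 i) (i2 j) = 0;
  wm_inv21 : forall w q i j, U1 w -> U2 q ->
    invmx (g (pt w q)) (i2 i) (i1 j) = 0;
  wm_inv22 : forall w q i j, U1 w -> U2 q ->
    invmx (g (pt w q)) (i2 i) (i2 j) = be w ^- 2 * invmx (g2 q) i j }.

(** Through this exchange, each identity proved for the first factor gives its counterpart for the
    second. *)
Lemma warped_metricC (R : realType) (n1 n2 n : nat) U1 U2 g1 g2 al be i1 i2 pt g :
  @warped_metric R n1 n2 n U1 U2 g1 g2 al be i1 i2 pt g ->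
  warped_metric U2 U1 g2 g1 be al i2 i1 (fun q w => pt w q) g.
Proof.
case=> m1 m2 w1 w2 sumE s1 s2 e11 e12 e21 e22 v11 v12 v21 v22.
by split=> // [F|q w i j Uq Uw|q w i j Uq Uw|q w i j Uq Uw|q w i j Uq Uw];
  [rewrite addrC|exact: v22|exact: v21|exact: v12|exact: v11].
Qed.

Section Christoffel.
Context {R : realType} {n1 n2 n : nat} {U1 : set 'rV[R]_n1} {U2 : set 'rV[R]_n2}.
Context {g1 : 'rV[R]_n1 -> 'M[R]_n1} {g2 : 'rV[R]_n2 -> 'M[R]_n2}.
Context {al : 'rV[R]_n2 -> R} {be : 'rV[R]_n1 -> R}.
Context {i1 : 'I_n1 -> 'I_n} {i2 : 'I_n2 -> 'I_n}.
Context {pt : 'rV[R]_n1 -> 'rV[R]_n2 -> 'rV[R]_n} {g : 'rV[R]_n -> 'M[R]_n}.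
Context (wg : warped_metric U1 U2 g1 g2 al be i1 i2 pt g).
Implicit Types (w : 'rV[R]_n1) (q : 'rV[R]_n2).

(** The two difference quotients are the same function of [h], so their limits coincide, whether or
    not they converge. *)
Lemma partial_slice1 (f : 'rV[R]_n -> R) w q i :
  partial (i1 i) f (pt w q) = partial i (fun x => f (pt x q)) w.
Proof.
have e : (fun h : R => h^-1 *: (f (h *: 'e_(i1 i) + pt w q) - f (pt w q))) =
    (fun h : R => h^-1 *: (f (pt (h *: 'e_i + w) q) - f (pt w q))).
  by apply/funext => h; rewrite (wm_slice1 wg).
exact: (congr1 (fun F : R -> R => lim (F @ 0^')) e).
Qed.

Lemma partial_slice2 (f : 'rV[R]_n -> R) w q i :
  partial (i2 i) f (pt w q) = partial i (fun x => f (pt w x)) q.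
Proof.
have e : (fun h : R => h^-1 *: (f (h *: 'e_(i2 i) + pt w q) - f (pt w q))) =
    (fun h : R => h^-1 *: (f (pt w (h *: 'e_i + q)) - f (pt w q))).
  by apply/funext => h; rewrite (wm_slice2 wg).
exact: (congr1 (fun F : R -> R => lim (F @ 0^')) e).
Qed.

Lemma partial1_entry11 w q i j k : U1 w ->
  partial (i1 i) (fun u => g u (i1 j) (i1 k)) (pt w q) =
  al q ^+ 2 * partial i (fun x => g1 x j k) w.
Proof.
move=> Uw; rewrite partial_slice1.
under [fun x => _]funext => x do rewrite (wm_entry11 wg).
rewrite partialZ//; apply: diff_derivable.
exact: local_diff (wm_metric1 wg) _ _ _ Uw.
Qed.

Lemma partial2_entry11 w q i j k : U2 q ->
  partial (i2 i) (fun u => g u (i1 j) (i1 k)) (pt w q) =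
  2 * al q ^+ 2 * partial i (log al) q * g1 w j k.
Proof.
move=> Uq; rewrite partial_slice2.
under [fun x => _]funext => x do rewrite (wm_entry11 wg).
have aq := wm_warping1 wg.
by rewrite partialZr ?(partial_sqr_warping aq)//; exact: (derivable_sqr_warping aq).
Qed.

Lemma partial1_entry12 w q i j k :
  partial (i1 i) (fun u => g u (i1 j) (i2 k)) (pt w q) = 0.
Proof.
rewrite partial_slice1.
by under [fun x => _]funext => x do rewrite (wm_entry12 wg); rewrite partial_cst.
Qed.

Lemma partial1_entry21 w q i j k :
  partial (i1 i) (fun u => g u (i2 j) (i1 k)) (pt w q) = 0.
Proof.
rewrite partial_slice1.
by under [fun x => _]funext => x do rewrite (wm_entry21 wg); rewrite partial_cst.
Qed.

(** [al] is constant along the first factor, so its square cancels against the inverse metric. *)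
Lemma christoffel111 w q k i j : U1 w -> U2 q ->
  christoffel g (i1 k) (i1 i) (i1 j) (pt w q) = christoffel g1 k i j w.
Proof.
move=> Uw Uq; rewrite /christoffel (wm_sum wg) [X in _ + X]big1 ?addr0; last first.
  by move=> l _; rewrite (wm_inv12 wg)// mul0r.
congr (_ * _); apply: eq_bigr => l _.
rewrite (wm_inv11 wg)// !partial1_entry11//.
have a0 : al q != 0 by exact: lt0r_neq0 (warping_gt0 (wm_warping1 wg) q).
by field.
Qed.

(** Only the derivative of [al ^+ 2] across the slice survives: this is the second fundamental form
    of a slice of constant [q]. *)
Lemma christoffel211 w q k i j : U1 w -> U2 q ->
  christoffel g (i2 k) (i1 i) (i1 j) (pt w q) =
  - be w ^- 2 * g1 w i j * (al q ^+ 2 * sharp g2 (log al) k q).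
Proof.
move=> Uw Uq; rewrite /christoffel (wm_sum wg) [X in X + _]big1 ?add0r; last first.
  by move=> l _; rewrite (wm_inv21 wg)// mul0r.
rewrite /sharp !mulr_sumr; apply: eq_bigr => l _.
rewrite (wm_inv22 wg)// !partial1_entry12// partial2_entry11//.
have b0 : be w != 0 by exact: lt0r_neq0 (warping_gt0 (wm_warping2 wg) w).
by field.
Qed.

(** The surviving derivative is twice that of ln [al] times the metric block itself, which the
    inverse metric contracts to a Kronecker delta. *)
Lemma christoffel112 w q k i j : U1 w -> U2 q ->
  christoffel g (i1 k) (i1 i) (i2 j) (pt w q) = (k == i)%:R * partial j (log al) q.
Proof.
move=> Uw Uq; rewrite /christoffel (wm_sum wg) [X in _ + X]big1 ?addr0; last first.
  by move=> l _; rewrite (wm_inv12 wg)// mul0r.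
rewrite -(local_mulVE (wm_metric1 wg) _ _ Uw) mulr_sumr mulr_suml.
apply: eq_bigr => l _.
rewrite (wm_inv11 wg)// partial1_entry21// partial2_entry11// partial1_entry12//.
rewrite (local_symE (wm_metric1 wg) l i)//.
have a0 : al q != 0 by exact: lt0r_neq0 (warping_gt0 (wm_warping1 wg) q).
by field.
Qed.

(** [christoffelC] concerns a [local_metric], which [warped_metric] does not assert of [g]; the
    bracketed derivatives are compared instead. *)
Lemma christoffel121 w q k i j : U1 w -> U2 q ->
  christoffel g (i1 k) (i2 j) (i1 i) (pt w q) = (k == i)%:R * partial j (log al) q.
Proof.
move=> Uw Uq; rewrite -(@christoffel112 w q)// /christoffel.
congr (_ * _); rewrite !(wm_sum wg).
congr (_ + _); apply: eq_bigr => l _; last by rewrite (wm_inv12 wg)// !mul0r.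
rewrite !partial1_entry21// !partial2_entry11// !partial1_entry12//.
by congr (_ * _); ring.
Qed.

End Christoffel.

(** * Ricci tensor and Hessian of a doubly warped metric *)

Section SharpFacts.
Context {R : realType} {n : nat} {U : set 'rV[R]_n} {g : 'rV[R]_n -> 'M[R]_n}.
Context (gU : local_metric U g).

Lemma lower_sharp u f j : U u -> \sum_m g u j m * sharp g f m u = partial j f u.
Proof.
move=> Uu; pose c := \col_l partial l f u.
have -> : \sum_m g u j m * sharp g f m u = (g u *m (invmx (g u) *m c)) j 0.
  rewrite mxE; apply: eq_bigr => m _; rewrite [in RHS]mxE; congr (_ * _).
  by apply: eq_bigr => l _; rewrite mxE.
by rewrite mulKVmx ?(local_unit gU)// mxE.
Qed.

(** This number is the inner product of df and dh. *)
Lemma mxtrace_inv_outer u (f h : 'rV[R]_n -> R) : U u ->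
  \tr (invmx (g u) *m ((grad f u)^T *m grad h u)) =
  \sum_m sharp g f m u * partial m h u.
Proof.
move=> Uu; rewrite mulmxA /mxtrace; apply: eq_bigr => m _.
rewrite !mxE big_ord1 !mxE; congr (_ * _).
by apply: eq_bigr => l _; rewrite !mxE.
Qed.

Lemma derivable_sharp u f k v : U u ->
  (forall l, derivable (partial l f) u v) -> derivable (sharp g f k) u v.
Proof.
move=> Uu df; apply: derivable_bigsum => l; apply: derivableM => //.
exact: (derivable_metric_inv gU).
Qed.

End SharpFacts.

Lemma hessianE (R : realType) (n : nat) (g : 'rV[R]_n -> 'M[R]_n) f u i j :
  hessian g f u i j = partial i (partial j f) u
  - \sum_k christoffel g k i j u * partial k f u.
Proof. by rewrite mxE. Qed.

Lemma ricciE (R : realType) (n : nat) (g : 'rV[R]_n -> 'M[R]_n) u j k :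
  ricci g u j k = \sum_i riemann g i k i j u.
Proof. by rewrite mxE. Qed.

(* Otherwise failed unifications unfold down to limits in R. *)
Local Opaque partial christoffel sharp hessian ricci.

Section WarpedRicci.
Context {R : realType} {n1 n2 n : nat} {U1 : set 'rV[R]_n1} {U2 : set 'rV[R]_n2}.
Context {g1 : 'rV[R]_n1 -> 'M[R]_n1} {g2 : 'rV[R]_n2 -> 'M[R]_n2}.
Context {al : 'rV[R]_n2 -> R} {be : 'rV[R]_n1 -> R}.
Context {i1 : 'I_n1 -> 'I_n} {i2 : 'I_n2 -> 'I_n}.
Context {pt : 'rV[R]_n1 -> 'rV[R]_n2 -> 'rV[R]_n} {g : 'rV[R]_n -> 'M[R]_n}.
Context (wg : warped_metric U1 U2 g1 g2 al be i1 i2 pt g).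
Let wg' := warped_metricC wg.
Context {x : 'rV[R]_n1} {p : 'rV[R]_n2}.
Context (Ux : U1 x) (Up : U2 p).

Let m1 := wm_metric1 wg.
Let m2 := wm_metric2 wg.
Local Notation a := (log al).
Local Notation b := (log be).
Local Notation normsq_da := (\sum_l sharp g2 a l p * partial l a p).
(** Entry (j, k) of the first diagonal block of [g], divided by [be x ^+ 2]. *)
Local Notation c j k := (be x ^- 2 * g1 x j k * al p ^+ 2).

(** The formulas for the symbols hold over [U1] and [U2] only; openness makes that enough to
    differentiate them. *)
Lemma partial1_near f h i : (forall w, U1 w -> f (pt w p) = h w) ->
  partial (i1 i) f (pt x p) = partial i h x.
Proof.
move=> fh; rewrite (partial_slice1 wg); apply: partial_near.
by apply: filterS (local_near m1 Ux) => w; exact: fh.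
Qed.

Lemma partial2_near f h i : (forall q, U2 q -> f (pt x q) = h q) ->
  partial (i2 i) f (pt x p) = partial i h p.
Proof.
move=> fh; rewrite (partial_slice2 wg); apply: partial_near.
by apply: filterS (local_near m2 Up) => w; exact: fh.
Qed.

(** The digits name the factors of the upper index and of the two lower ones. These four are the
    earlier symbols with the factors exchanged. *)
Let christoffel222 := christoffel111 wg'.
Let christoffel122 := christoffel211 wg'.
Let christoffel221 := christoffel112 wg'.
Let christoffel212 := christoffel121 wg'.

(** Gauss equation for the slice: the corrections pair a mixed symbol with the second fundamental
    form. The upper index equals the first direction because Ricci traces over that pair. *)
Lemma riemann1111 i k j :
  riemann g (i1 i) (i1 k) (i1 i) (i1 j) (pt x p) =
  riemann g1 i k i j x - c j k * normsq_da + (i == j)%:R * c i k * normsq_da.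
Proof.
rewrite /riemann (wm_sum wg).
have dE l k' j' : partial (i1 l) (christoffel g (i1 i) (i1 k') (i1 j')) (pt x p) =
    partial l (christoffel g1 i k' j') x.
  by apply: partial1_near => w Uw; rewrite (christoffel111 wg).
rewrite !dE.
under eq_bigr => m _ do rewrite !(christoffel111 wg)//.
under [X in _ + (_ + X)]eq_bigr => m _ do
  rewrite !(christoffel112 wg)// !(christoffel211 wg)// eqxx.
rewrite -!addrA; do 3 congr (_ + _).
rewrite !mulr_sumr -sumrN -big_split/=.
by apply: eq_bigr => l _; ring.
Qed.

(** Arranged for summation over [l]: the derivative of [sharp] and the last sum then form the
    divergence of the gradient of a. *)
Lemma riemann2121 l k j :
  riemann g (i2 l) (i1 k) (i2 l) (i1 j) (pt x p) =
  - c j k * partial l (sharp g2 a l) p - c j k * (sharp g2 a l p * partial l a p)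
  - hessian g1 b x j k - partial j b x * partial k b x
  - c j k * \sum_m christoffel g2 l l m p * sharp g2 a m p.
Proof.
rewrite /riemann (wm_sum wg).
rewrite (@partial2_near _
  (fun q => - be x ^- 2 * g1 x j k * (al q ^+ 2 * sharp g2 a l q)));
  last by move=> q Uq; rewrite (christoffel211 wg).
rewrite (@partial1_near _ (partial k b)); last first.
  by move=> w Uw; rewrite christoffel221// eqxx mul1r.
have da : derivable (fun q => al q ^+ 2) p 'e_l.
  exact: (derivable_sqr_warping (wm_warping1 wg)).
have ds : derivable (sharp g2 a l) p 'e_l.
  apply: (derivable_sharp m2); [exact: Up|move=> m].
  exact: (derivable_partial_log (local_open m2) (wm_warping1 wg)).
rewrite (partialZ _ (derivableM da ds)).
rewrite (partialM da ds) (partial_sqr_warping (wm_warping1 wg))//.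
(* Indices of the first factor: the first product completes the second derivatives of b to its
   Hessian, the second survives for [m = k] only. *)
rewrite hessianE [X in _ + (X + _)](_ : _ =
  \sum_m christoffel g1 m j k x * partial m b x
  + c j k * (sharp g2 a l p * partial l a p)); last first.
  rewrite sumrB; congr (_ + _).
    apply: eq_bigr => m _.
    by rewrite christoffel221// (christoffel111 wg)// eqxx !mul1r; ring.
  rewrite (bigD1 k)//= [X in _ + X]big1 ?addr0 => [|m mk].
    by rewrite (christoffel211 wg)// (christoffel121 wg)// eqxx !mul1r; ring.
  by rewrite (christoffel121 wg)// (negbTE mk) mul0r mulr0.
(* Indices of the second factor: the first product is the connection term of the divergence, the
   second survives for [m = l] only. *)
rewrite [X in _ + (_ + X)](_ : _ =
  - c j k * (\sum_m christoffel g2 l l m p * sharp g2 a m p)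
  - partial j b x * partial k b x); last first.
  rewrite sumrB; congr (_ - _).
    rewrite mulr_sumr; apply: eq_bigr => m _.
    by rewrite christoffel222// (christoffel211 wg)//; ring.
  rewrite (bigD1 l)//= [X in _ + X]big1 ?addr0 => [|m ml].
    rewrite (christoffel212 _ _ _ Up Ux) (christoffel221 _ _ _ Up Ux) eqxx.
    by congr (_ * _); rewrite mul1r.
  by rewrite christoffel212// eq_sym (negbTE ml) mul0r mul0r.
move: (partial j (partial k b) x) (partial j b x) (partial k b x) => bjk bj bk.
move: (partial l (sharp g2 a l) p) (partial l a p) (sharp g2 a l p) => d1 d2 s.
move: (\sum_m _) (\sum_m _) => S S'.
by ring.
Qed.

(** The Kronecker term of [riemann1111] cancels the summed product of gradient and da in
    [riemann2121], which leaves [n1] copies of |da|^2; the divergence becomes the trace of the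
    Hessian. *)
Lemma ricci_warped11 j k :
  ricci g (pt x p) (i1 j) (i1 k) =
  ricci g1 x j k - n2%:R * (hessian g1 b x j k + partial j b x * partial k b x)
  - c j k * (\tr (invmx (g2 p) *m hessian g2 a p) + n1%:R * normsq_da).
Proof.
rewrite [LHS]ricciE (wm_sum wg).
under eq_bigr => i _ do rewrite riemann1111.
rewrite 2!big_split/= -ricciE; move: (ricci g1 x j k) => T.
under [X in _ + X]eq_bigr => i _ do rewrite riemann2121.
rewrite -(divergence_sharp m2 Up); last first.
  by move=> k' l; exact: (derivable_partial_log (local_open m2) (wm_warping1 wg)).
rewrite !big_split/= !sumrN !sumr_const !card_ord -!mulr_sumr.
rewrite [X in _ - _ + X](_ : _ = c j k * normsq_da); last first.
  rewrite (bigD1 j)//= [X in _ + X]big1 ?addr0 => [|l /negbTE lj].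
    by rewrite eqxx mul1r.
  by rewrite lj !mul0r.
rewrite (_ : \sum_l \sum_m christoffel g2 l l m p * sharp g2 a m p =
    \sum_m (\sum_k christoffel g2 k k m p) * sharp g2 a m p); last first.
  by rewrite exchange_big; apply: eq_bigr => m _; rewrite mulr_suml.
rewrite -(mulr_natl (c j k * normsq_da)) -(mulr_natl (hessian g1 b x j k)).
rewrite -(mulr_natl (partial j b x * partial k b x)).
move: (hessian g1 b x j k) (partial j b x) (partial k b x) => h bj bk.
set S1 := normsq_da.
set S2 := \sum_m (\sum_k christoffel g2 k k m p) * sharp g2 a m p.
set S3 := \sum_k partial k (sharp g2 a k) p.
move: S1 S2 S3 => S1 S2 S3.
by ring.
Qed.

(** The symbols to be differentiated do not vary along the first factor, so only products remain.
    Kronecker deltas collapse their sums, and the two symbols of [g1] cancel by symmetry. *)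
Lemma riemann1112 i k j :
  riemann g (i1 i) (i2 k) (i1 i) (i1 j) (pt x p) =
  (1 - (i == j)%:R) * (partial j b x * partial k a p).
Proof.
rewrite /riemann (wm_sum wg).
rewrite (@partial1_near _ (fun=> (i == j)%:R * partial k a p)); last first.
  by move=> w Uw; rewrite (christoffel112 wg _ _ _ Uw Up).
rewrite (@partial1_near _ (fun=> (i == i)%:R * partial k a p)); last first.
  by move=> w Uw; rewrite (christoffel112 wg _ _ _ Uw Up).
rewrite !partial_cst subrr add0r !sumrB.
rewrite (bigD1 j)//= [X in _ + X - _]big1 ?addr0; last first.
  move=> m /negbTE mj; rewrite [X in _ * X](christoffel112 wg _ _ _ Ux Up).
  by rewrite mj mul0r mulr0.
rewrite (bigD1 i)//= [X in _ - (_ + X)]big1 ?addr0; last first.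
  move=> m /negbTE mi; rewrite [X in _ * X](christoffel112 wg _ _ _ Ux Up).
  by rewrite mi mul0r mulr0.
rewrite !(christoffel111 wg _ _ _ Ux Up) !(christoffel112 wg _ _ _ Ux Up).
rewrite (christoffelC m1 _ j i Ux) !eqxx subrr add0r.
rewrite (bigD1 k)//= [X in _ + X - _]big1 ?addr0; last first.
  move=> m /negbTE mk; rewrite [X in _ * X](christoffel212 _ _ _ Up Ux).
  by rewrite mk mul0r mulr0.
rewrite (bigD1 k)//= [X in _ - (_ + X)]big1 ?addr0; last first.
  move=> m /negbTE mk; rewrite [X in _ * X](christoffel212 _ _ _ Up Ux).
  by rewrite mk mul0r mulr0.
rewrite !(christoffel112 wg _ _ _ Ux Up) !(christoffel212 _ _ _ Up Ux) !eqxx.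
have [->|_] := eqVneq i j; first by rewrite /= !subrr mul0r.
by rewrite /= !mul0r !subr0 !mul1r mulrC.
Qed.

Lemma riemann2122 l k j :
  riemann g (i2 l) (i2 k) (i2 l) (i1 j) (pt x p) =
  partial j b x * partial k a p
  - partial j b x * (g2 p l k * sharp g2 a l p).
Proof.
rewrite /riemann (wm_sum wg).
rewrite (@partial2_near _ (fun=> (l == k)%:R * partial j b x)); last first.
  by move=> q Uq; rewrite (christoffel212 _ _ _ Uq Ux).
rewrite (@partial1_near _ (fun=> christoffel g2 l l k p)); last first.
  by move=> w Uw; rewrite (christoffel222 _ _ _ Up Uw).
rewrite !partial_cst subrr add0r !sumrB.
rewrite (bigD1 j)//= [X in _ + X - _]big1 ?addr0; last first.
  move=> m /negbTE mj; rewrite [X in _ * X](christoffel112 wg _ _ _ Ux Up).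
  by rewrite mj mul0r mulr0.
rewrite (christoffel221 _ _ _ Up Ux) (christoffel112 wg _ _ _ Ux Up) !eqxx !mul1r.
(* The second fundamental forms of the two kinds of slices are multiplied: the warping factors
   cancel, and lowering the index of the gradient of b gives its partial derivative. *)
rewrite (_ : \sum_m _ =
  (\sum_m g1 x j m * sharp g1 b m x) * (g2 p l k * sharp g2 a l p));
  last first.
  rewrite mulr_suml; apply: eq_bigr => m _.
  rewrite (christoffel211 wg _ _ _ Ux Up) (christoffel122 _ _ _ Up Ux).
  have a0 : al p != 0 by exact: lt0r_neq0 (warping_gt0 (wm_warping1 wg) p).
  have b0 : be x != 0 by exact: lt0r_neq0 (warping_gt0 (wm_warping2 wg) x).
  move: (sharp g1 b m x) (sharp g2 a l p) (g1 x j m) (g2 p l k) => s1 s2 t1 t2.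
  by field; rewrite a0 b0.
rewrite (lower_sharp m1 _ _ Ux).
rewrite (bigD1 k)//= [X in _ + (_ + X - _)]big1 ?addr0; last first.
  move=> m /negbTE mk; rewrite [X in _ * X](christoffel212 _ _ _ Up Ux).
  by rewrite mk mul0r mulr0.
rewrite (bigD1 l)//= [X in _ - (_ + X)]big1 ?addr0; last first.
  move=> m /negbTE ml; rewrite [X in X * _](christoffel212 _ _ _ Up Ux).
  by rewrite eq_sym ml !mul0r.
rewrite !(christoffel212 _ _ _ Up Ux) !(christoffel222 _ _ _ Up Ux) !eqxx.
by rewrite [X in _ + (X - _)]mulrC subrr addr0.
Qed.

(** The first factor contributes [n1 - 1]. The second contributes [n2], less one for the metric
    contracted with the gradient of a. *)
Lemma ricci_warped12 j k :
  ricci g (pt x p) (i1 j) (i2 k) =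
  (n1%:R + n2%:R - 2) * (partial j b x * partial k a p).
Proof.
rewrite [LHS]ricciE (wm_sum wg).
under eq_bigr => i _ do rewrite riemann1112.
under [X in _ + X]eq_bigr => i _ do rewrite riemann2122.
rewrite -mulr_suml sumrB sumr_const card_ord (bigD1 j)//=.
rewrite [X in _ - (_ + X)]big1 => [|l /negbTE lj]; last by rewrite lj.
rewrite eqxx sumrB sumr_const card_ord -mulr_sumr.
rewrite (_ : \sum_l g2 p l k * sharp g2 a l p = partial k a p); last first.
  rewrite -(lower_sharp m2 _ _ Up); apply: eq_bigr => l _.
  by rewrite (local_symE m2 _ _ Up).
rewrite -[X in _ + (X - _)]mulr_natl.
move: (partial j b x) (partial k a p) => bj ak; rewrite /= addr0 mulr1n.
ring.
Qed.

(** * Hessian of a sum of functions of the two factors *)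

Section WarpedHessian.
Context {f : 'rV[R]_n -> R} {f1 : 'rV[R]_n1 -> R} {f2 : 'rV[R]_n2 -> R}.
Context (fE : forall w q, f (pt w q) = f1 w + f2 q).
Context (df1 : forall w, U1 w -> differentiable f1 w).
Context (df2 : forall q, U2 q -> differentiable f2 q).

Lemma partial1_split w q i : U1 w -> partial (i1 i) f (pt w q) = partial i f1 w.
Proof.
move=> Uw; rewrite (partial_slice1 wg).
under [fun x => _]funext => u do rewrite fE.
rewrite partialD; first by rewrite partial_cst addr0.
  exact/diff_derivable/df1.
exact: derivable_cst.
Qed.

Lemma partial2_split w q i : U2 q -> partial (i2 i) f (pt w q) = partial i f2 q.
Proof.
move=> Uq; rewrite (partial_slice2 wg).
under [fun x => _]funext => u do rewrite fE.
rewrite partialD; first by rewrite partial_cst add0r.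
  exact: derivable_cst.
exact/diff_derivable/df2.
Qed.

Lemma hessian_warped11 i j :
  hessian g f (pt x p) (i1 i) (i1 j) =
  hessian g1 f1 x i j + c i j * \sum_l sharp g2 a l p * partial l f2 p.
Proof.
rewrite !hessianE (wm_sum wg).
rewrite (@partial1_near _ (partial j f1)); last by move=> w Uw; exact: partial1_split.
rewrite opprD addrA; congr (_ - _ + _).
  apply: eq_bigr => m _.
  by rewrite (christoffel111 wg _ _ _ Ux Up) (partial1_split _ _ Ux).
rewrite -sumrN mulr_sumr; apply: eq_bigr => l _.
rewrite (christoffel211 wg _ _ _ Ux Up) (partial2_split _ _ Up).
by move: (sharp g2 a l p) (partial l f2 p) => s d; ring.
Qed.

(** The mixed second derivative of a split function vanishes; both terms come from the mixed
    Christoffel symbols. *)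
Lemma hessian_warped12 i j :
  hessian g f (pt x p) (i1 i) (i2 j) =
  - (partial j a p * partial i f1 x + partial i b x * partial j f2 p).
Proof.
rewrite hessianE (wm_sum wg).
rewrite (@partial1_near _ (fun=> partial j f2 p)); last first.
  by move=> w Uw; exact: partial2_split.
rewrite partial_cst add0r; congr (- (_ + _)).
  rewrite (bigD1 i)//= big1 ?addr0 => [|m /negbTE mi].
    by rewrite (christoffel112 wg _ _ _ Ux Up) (partial1_split _ _ Ux) eqxx mul1r.
  by rewrite (christoffel112 wg _ _ _ Ux Up) mi !mul0r.
rewrite (bigD1 j)//= big1 ?addr0 => [|m /negbTE mj].
  by rewrite (christoffel212 _ _ _ Up Ux) (partial2_split _ _ Up) eqxx mul1r.
by rewrite (christoffel212 _ _ _ Up Ux) mj !mul0r.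
Qed.

End WarpedHessian.

End WarpedRicci.

(** Weaker than C^2: the first partial derivatives have directional derivatives, whose continuity is
    not included. *)
Definition C2_on (R : realType) (n : nat) (U : set 'rV[R]_n) (f : 'rV[R]_n -> R) :=
  forall u, U u ->
    differentiable f u /\ forall k v, derivable (partial k f) u v.

Lemma C2_log (R : realType) (n : nat) (U : set 'rV[R]_n) (al : 'rV[R]_n -> R) :
  open U -> local_warping U al -> C2_on U (log al).
Proof.
move=> oU alU u Uu; split; first exact: (differentiable_log alU).
by move=> k v; exact: (derivable_partial_log oU alU).
Qed.

(** * Linearity of the Hessian *)

Section HessianLinear.
Context {R : realType} {n : nat} {U : set 'rV[R]_n} {g : 'rV[R]_n -> 'M[R]_n}.
Context (gU : local_metric U g).
Context {f h : 'rV[R]_n -> R} (r : R).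
Context (fU : C2_on U f) (hU : C2_on U h).

Lemma partial_affine k u : U u ->
  partial k (fun w => f w + r * h w) u = partial k f u + r * partial k h u.
Proof.
move=> Uu; have df k' : derivable f u 'e_k' by apply: diff_derivable; case: (fU Uu).
have dh k' : derivable h u 'e_k' by apply: diff_derivable; case: (hU Uu).
rewrite (partialD (df _) (derivableM (derivable_cst _ _ _) (dh _))).
by rewrite partialZ.
Qed.

Lemma hessian_affine u i j : U u ->
  hessian g (fun w => f w + r * h w) u i j =
  hessian g f u i j + r * hessian g h u i j.
Proof.
move=> Uu; rewrite !hessianE.
have -> : partial i (partial j (fun w => f w + r * h w)) u =
    partial i (partial j f) u + r * partial i (partial j h) u.
  have [_ d2f] := fU Uu; have [_ d2h] := hU Uu.
  rewrite -(partialZ _ (d2h _ _)) -partialD.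
  - apply: partial_near; apply: filterS (local_near gU Uu) => w Uw.
    exact: partial_affine.
  - exact: d2f.
  - exact: derivableM.
under eq_bigr => k _ do rewrite (partial_affine _ Uu) mulrDr.
rewrite big_split/= [in RHS]mulrBr opprD addrACA; congr (_ + (_ - _)).
by rewrite mulr_sumr; apply: eq_bigr => k _; rewrite mulrCA.
Qed.

End HessianLinear.

Lemma differentiable_affine (R : realType) m (U : set 'rV[R]_m) f h (r : R) :
  C2_on U f -> C2_on U h ->
  forall u, U u -> differentiable (fun w => f w + r * h w) u.
Proof.
move=> fU hU u Uu; apply: differentiableD; first by case: (fU u Uu).
by apply: differentiableM; [exact: differentiable_cst|case: (hU u Uu)].
Qed.

(** * Ricci tensor plus Hessian of the weight, block by block *)

Section BakryEmeryBlocks.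
Context {R : realType} {n1 n2 n : nat} {U1 : set 'rV[R]_n1} {U2 : set 'rV[R]_n2}.
Context {g1 : 'rV[R]_n1 -> 'M[R]_n1} {g2 : 'rV[R]_n2 -> 'M[R]_n2}.
Context {al : 'rV[R]_n2 -> R} {be : 'rV[R]_n1 -> R}.
Context {i1 : 'I_n1 -> 'I_n} {i2 : 'I_n2 -> 'I_n}.
Context {pt : 'rV[R]_n1 -> 'rV[R]_n2 -> 'rV[R]_n} {g : 'rV[R]_n -> 'M[R]_n}.
Context (wg : warped_metric U1 U2 g1 g2 al be i1 i2 pt g).
Context {phi : 'rV[R]_n1 -> R} {psi : 'rV[R]_n2 -> R} {chi : 'rV[R]_n -> R}.
Context {R1 R2 : R}.
Context (phiU : C2_on U1 phi) (psiU : C2_on U2 psi).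
Context (chiE : forall w q, chi (pt w q) =
  (phi w + (n2%:R - R2) * log be w) + (psi q + (n1%:R - R1) * log al q)).
Context {x : 'rV[R]_n1} {p : 'rV[R]_n2}.
Context (Ux : U1 x) (Up : U2 p).

Let alU := wm_warping1 wg.
Let beU := wm_warping2 wg.
Let C2a := C2_log (local_open (wm_metric2 wg)) alU.
Let C2b := C2_log (local_open (wm_metric1 wg)) beU.

Let d1 := @differentiable_affine _ _ _ _ _ (n2%:R - R2) phiU C2b.
Let d2 := @differentiable_affine _ _ _ _ _ (n1%:R - R1) psiU C2a.

(** The weight is tuned for this: [- n2] Hessians of b from Ricci and [n2 - R2] from [chi] leave
    [- R2], while in the trace [n1] and [n1 - R1] copies of |da|^2 leave [R1]. *)
Lemma ricci_hessian11 j k :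
  (ricci g (pt x p) + hessian g chi (pt x p)) (i1 j) (i1 k) =
  (ricci g1 x + hessian g1 phi x - R2 *: hessian g1 (log be) x
   - n2%:R *: ((grad (log be) x)^T *m grad (log be) x)
   - (be x ^- 2 * al p ^+ 2 *
      \tr (invmx (g2 p) *m (hessian g2 (log al) p
        + R1 *: ((grad (log al) p)^T *m grad (log al) p)
        - (grad (log al) p)^T *m grad psi p))) *: g1 x) j k.
Proof.
have h := hessian_warped11 wg Ux Up chiE d1 d2 j k.
rewrite (hessian_affine (wm_metric1 wg) _ phiU C2b _ _ Ux) in h.
have e : \sum_l sharp g2 (log al) l p *
    partial l (fun q => psi q + (n1%:R - R1) * log al q) p =
    \sum_l sharp g2 (log al) l p * partial l psi p
    + (n1%:R - R1) * \sum_l sharp g2 (log al) l p * partial l (log al) p.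
  rewrite mulr_sumr -big_split/=; apply: eq_bigr => l _.
  by rewrite (partial_affine _ psiU C2a _ Up) mulrDr mulrCA.
rewrite e in h.
rewrite [LHS]mxE (ricci_warped11 wg Ux Up) h.
rewrite [RHS]mxE [X in _ = X + _]mxE [X in _ = X + _ + _]mxE.
rewrite [X in _ = X + _ + _ + _]mxE.
set tS := \tr (_ *m (_ + _)).
have {tS}-> : tS = \tr (invmx (g2 p) *m hessian g2 (log al) p)
    + R1 * (\sum_l sharp g2 (log al) l p * partial l (log al) p)
    - \sum_l sharp g2 (log al) l p * partial l psi p.
  rewrite /tS mulmxBr mulmxDr -scalemxAr !raddfD/= raddfN/= mxtraceZ.
  by rewrite !(mxtrace_inv_outer _ _ Up).
move: (\tr _) (ricci g1 x) (hessian g1 phi x) (hessian g1 (log be) x) => t A B C.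
move: (\sum_l sharp _ _ l p * _) (\sum_l sharp _ _ l p * _) => s1 s2.
rewrite !mxE big_ord1 !mxE.
move: (partial j _ _) (partial k _ _) => bj bk.
by ring.
Qed.

Lemma ricci_hessian12 j k :
  (ricci g (pt x p) + hessian g chi (pt x p)) (i1 j) (i2 k) =
  ((R1 + R2 - 2) *: ((grad (log be) x)^T *m grad (log al) p)
   - (grad phi x)^T *m grad (log al) p
   - (grad (log be) x)^T *m grad psi p) j k.
Proof.
rewrite [LHS]mxE (ricci_warped12 wg Ux Up) (hessian_warped12 wg Ux Up chiE d1 d2).
rewrite (partial_affine _ phiU C2b _ Ux) (partial_affine _ psiU C2a _ Up).
rewrite !mxE !big_ord1 !mxE.
move: (partial j (log be) x) (partial k (log al) p) => bj ak.
move: (partial j phi x) (partial k psi p) => dj dk.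
by ring.
Qed.

End BakryEmeryBlocks.

(** * The curvature bound in a chart *)

(** [P], [b], [Q], [a] stand for XPhi, Xb, VPsi, Va; [k1], [k2] for the dimensions and [m1], [m2]
    for the gaps N_i - n_i. Since [eta] is chosen before the four derivatives, it serves all
    manifolds and points. *)
Lemma cross_terms_bound (R : realType) (k1 k2 R1 R2 m1 m2 : R) :
  0 < m1 -> 0 < m2 -> 0 <= k1 -> 0 <= k2 -> 0 <= R1 -> 0 <= R2 ->
  exists eta : R,
  [/\ R1 ^+ 2 + R1 <= - eta, R2 ^+ 2 + R2 <= - eta &
  forall P b Q a : R,
    0 <= m1^-1 * P ^+ 2 + m2^-1 * Q ^+ 2 - eta * (P ^+ 2 + b ^+ 2)
      - eta * (Q ^+ 2 + a ^+ 2) - k2 * b ^+ 2 - k1 * a ^+ 2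
      + 2 * ((R1 + R2 - 2) * (b * a) - P * a - b * Q)
      - (m1 + m2)^-1 * (P + (k2 - R2) * b + (Q + (k1 - R1) * a)) ^+ 2].
Proof.
move=> m1_gt0 m2_gt0 k1_ge0 k2_ge0 R1_ge0 R2_ge0.
set r1 := k1 - R1; set r2 := k2 - R2; set k := R1 + R2 - 2.
set D := (m1 + m2)^-1.
have D_ge0 : 0 <= D by rewrite invr_ge0 addr_ge0// ltW.
pose K := 4 * (1 + r1 ^+ 2 + r2 ^+ 2).
have K_ge0 : 0 <= K by rewrite /K; have := sqr_ge0 r1; have := sqr_ge0 r2; lra.
have DK_ge0 : 0 <= D * K by exact: mulr_ge0.
have s1 : 0 <= R1 ^+ 2 by exact: sqr_ge0.
have s2 : 0 <= R2 ^+ 2 by exact: sqr_ge0.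
have k_ge0 : 0 <= `|k| by [].
(* [D * K] pays for the square of d chi, [k1] and [k2] for the negative squares, the absolute value
   of [k] for the product of [b] and [a], and 1 for the products [P * a] and [b * Q]. The last two
   summands give the first two claims. *)
exists (- (D * K + k1 + k2 + `|k| + 1 + (R1 ^+ 2 + R1) + (R2 ^+ 2 + R2))).
split; [lra|lra|] => P b Q a.
have Pm : 0 <= m1^-1 * P ^+ 2 by rewrite mulr_ge0 ?invr_ge0 ?sqr_ge0 ?ltW.
have Qm : 0 <= m2^-1 * Q ^+ 2 by rewrite mulr_ge0 ?invr_ge0 ?sqr_ge0 ?ltW.
have P2 := sqr_ge0 P; have Q2 := sqr_ge0 Q.
have a2 := sqr_ge0 a; have b2 := sqr_ge0 b.
pose S := P ^+ 2 + b ^+ 2 + Q ^+ 2 + a ^+ 2.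
(* Cauchy-Schwarz for four terms gives the factor 4; each remaining coefficient 1, [r1 ^+ 2],
   [r2 ^+ 2] is at most their sum. *)
have sq4 : (P + r2 * b + (Q + r1 * a)) ^+ 2 <= K * S.
  apply: (@le_trans _ _ (4 * (P ^+ 2 + (r2 * b) ^+ 2 + Q ^+ 2 + (r1 * a) ^+ 2))).
    move: (r2 * b) (r1 * a) => y z.
    have := sqr_ge0 (P - y); have := sqr_ge0 (P - Q); have := sqr_ge0 (P - z).
    have := sqr_ge0 (y - Q); have := sqr_ge0 (y - z); have := sqr_ge0 (Q - z).
    rewrite !sqrrB => *; lra.
  rewrite /K -mulrA ler_pM2l// !exprMn /S.
  have e1 := mulr_ge0 (sqr_ge0 r1) (addr_ge0 (addr_ge0 P2 b2) Q2).
  have e2 := mulr_ge0 (sqr_ge0 r2) (addr_ge0 (addr_ge0 P2 Q2) a2).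
  move: (r1 ^+ 2) (r2 ^+ 2) e1 e2 => t1 t2 e1 e2; lra.
have DS := ler_wpM2l D_ge0 sq4.
have kab : - (`|k| * (a ^+ 2 + b ^+ 2)) <= 2 * (k * (b * a)).
  have e1 := mulr_ge0 k_ge0 (sqr_ge0 (a + b)).
  have e2 := mulr_ge0 k_ge0 (sqr_ge0 (a - b)).
  have [k0|k0] := ger0P k.
    by rewrite (ger0_norm k0) in e1 e2 *; nra.
  by rewrite (ltr0_norm k0) in e1 e2 *; nra.
have Pa : - (P ^+ 2 + a ^+ 2) <= - (2 * (P * a)).
  have := sqr_ge0 (P - a); rewrite sqrrB; lra.
have bQ : - (b ^+ 2 + Q ^+ 2) <= - (2 * (b * Q)).
  have := sqr_ge0 (b - Q); rewrite sqrrB; lra.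
have k1S : k1 * a ^+ 2 <= k1 * S by rewrite ler_wpM2l// /S; lra.
have k2S : k2 * b ^+ 2 <= k2 * S by rewrite ler_wpM2l// /S; lra.
have kS : `|k| * (a ^+ 2 + b ^+ 2) <= `|k| * S by rewrite ler_wpM2l// /S; lra.
have S_ge0 : 0 <= S by rewrite /S; lra.
have RS1 := mulr_ge0 (addr_ge0 s1 R1_ge0) S_ge0.
have RS2 := mulr_ge0 (addr_ge0 s2 R2_ge0) S_ge0.
set T := (P + _ + _) ^+ 2 in sq4 DS *.
have ST : P ^+ 2 + a ^+ 2 + (b ^+ 2 + Q ^+ 2) = S by rewrite /S; lra.
(* Once the [eta] terms are written as multiples of [S], the bounds collected above add up by linear
   arithmetic. *)
set e := - (_ + _).
have eS : e * (P ^+ 2 + b ^+ 2) + e * (Q ^+ 2 + a ^+ 2) = e * S by rewrite /S; ring.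
have e'S : - (e * S) = D * (K * S) + k1 * S + k2 * S + `|k| * S + S
  + (R1 ^+ 2 + R1) * S + (R2 ^+ 2 + R2) * S by rewrite /e; ring.
lra.
Qed.

Lemma mul_outer_comb (R : realType) m n c (r1 r2 r3 v : 'rV[R]_m)
    (s1 s2 s3 w : 'rV[R]_n) :
  (v *m (c *: (r1^T *m s1) - r2^T *m s2 - r3^T *m s3) *m w^T) 0 0 =
  c * ((r1 *m v^T) 0 0 * (s1 *m w^T) 0 0) - (r2 *m v^T) 0 0 * (s2 *m w^T) 0 0
  - (r3 *m v^T) 0 0 * (s3 *m w^T) 0 0.
Proof.
rewrite !mulmxBr !mulmxBl -scalemxAr -scalemxAl -!mul_outer.
by rewrite [LHS]mxE [X in X + _]mxE [X in X + _ + _]mxE [X in _ + X + _]mxE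
  [X in _ + _ + X]mxE.
Qed.

(** For [f] = ln alpha and nonzero [r], the metric trace is the drift Laplacian of alpha^r for the
    weight e^{-h}, divided by r alpha^r. *)
Definition drift_hessian (R : realType) n (g : 'rV[R]_n -> 'M[R]_n)
    (f h : 'rV[R]_n -> R) (r : R) u : 'M[R]_n :=
  hessian g f u + r *: ((grad f u)^T *m grad f u) - (grad f u)^T *m grad h u.

Section WarpedCurvatureBound.
Context {R : realType} {n1 n2 : nat} {U1 : set 'rV[R]_n1} {U2 : set 'rV[R]_n2}.
Context {g1 : 'rV[R]_n1 -> 'M[R]_n1} {g2 : 'rV[R]_n2 -> 'M[R]_n2}.
Context {al : 'rV[R]_n2 -> R} {be : 'rV[R]_n1 -> R}.
Context (g1U : local_metric U1 g1) (g2U : local_metric U2 g2).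
Context (alU : local_warping U2 al) (beU : local_warping U1 be).

Local Notation g := (fun u : 'rV[R]_(n1 + n2) =>
  block_mx (al (rsubmx u) ^+ 2 *: g1 (lsubmx u)) 0
           0 (be (lsubmx u) ^+ 2 *: g2 (rsubmx u))).

Lemma warped_metric_row :
  warped_metric U1 U2 g1 g2 al be (@lshift n1 n2) (@rshift n1 n2)
    (fun w q => row_mx w q) g.
Proof.
have gE w q : g (row_mx w q) = block_mx (al q ^+ 2 *: g1 w) 0 0 (be w ^+ 2 *: g2 q).
  by rewrite row_mxKl row_mxKr.
have a0 q : al q ^+ 2 != 0 by rewrite expf_neq0// lt0r_neq0// (warping_gt0 alU).
have b0 w : be w ^+ 2 != 0 by rewrite expf_neq0// lt0r_neq0// (warping_gt0 beU).
have iE w q : U1 w -> U2 q -> invmx (g (row_mx w q)) =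
    block_mx (al q ^- 2 *: invmx (g1 w)) 0 0 (be w ^- 2 *: invmx (g2 q)).
  move=> Uw Uq; rewrite gE.
  have u1 : al q ^+ 2 *: g1 w \in unitmx by rewrite unitmxZ ?unitfE// (local_unit g1U).
  have u2 : be w ^+ 2 *: g2 q \in unitmx by rewrite unitmxZ ?unitfE// (local_unit g2U).
  by rewrite invmx_block_diag ?unitmxE ?det_lblock ?unitrM -?unitmxE ?u1// !invmxZ.
have e1 i : 'e_(lshift n2 i) = row_mx 'e_i 0 :> 'rV[R]_(n1 + n2).
  apply/rowP => j; rewrite !mxE; case: split_ordP => l ->; rewrite !mxE eqxx.
    by rewrite eq_lshift.
  by rewrite eq_rlshift.
have e2 i : 'e_(rshift n1 i) = row_mx 0 'e_i :> 'rV[R]_(n1 + n2).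
  apply/rowP => j; rewrite !mxE; case: split_ordP => l ->; rewrite !mxE eqxx.
    by rewrite eq_lrshift.
  by rewrite eq_rshift.
split=> //.
- by move=> f; rewrite big_split_ord.
- by move=> w q i h; rewrite e1 scale_row_mx scaler0 add_row_mx add0r.
- by move=> w q i h; rewrite e2 scale_row_mx scaler0 add_row_mx add0r.
- by move=> w q i j; rewrite gE block_mxEul mxE.
- by move=> w q i j; rewrite gE block_mxEur mxE.
- by move=> w q i j; rewrite gE block_mxEdl mxE.
- by move=> w q i j; rewrite gE block_mxEdr mxE.
- by move=> w q i j Uw Uq; rewrite iE// block_mxEul mxE.
- by move=> w q i j Uw Uq; rewrite iE// block_mxEur mxE.
- by move=> w q i j Uw Uq; rewrite iE// block_mxEdl mxE.
- by move=> w q i j Uw Uq; rewrite iE// block_mxEdr mxE.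
Qed.

Context {phi : 'rV[R]_n1 -> R} {psi : 'rV[R]_n2 -> R} {chi : 'rV[R]_(n1 + n2) -> R}.
Context {R1 R2 : R}.
Context (phiU : C2_on U1 phi) (psiU : C2_on U2 psi).
Context (chiE : forall w q, chi (row_mx w q) =
  (phi w + (n2%:R - R2) * log be w) + (psi q + (n1%:R - R1) * log al q)).
Context {x : 'rV[R]_n1} {p : 'rV[R]_n2}.
Context (Ux : U1 x) (Up : U2 p).

Local Notation a := (log al).
Local Notation b := (log be).

(** The two lower blocks are the upper ones with the factors exchanged by [warped_metricC]. *)
Lemma ricci_hessian_block :
  ricci g (row_mx x p) + hessian g chi (row_mx x p) =
  block_mx
    (ricci g1 x + hessian g1 phi x - R2 *: hessian g1 b x
     - n2%:R *: ((grad b x)^T *m grad b x)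
     - (be x ^- 2 * al p ^+ 2
        * \tr (invmx (g2 p) *m drift_hessian g2 a psi R1 p)) *: g1 x)
    ((R1 + R2 - 2) *: ((grad b x)^T *m grad a p) - (grad phi x)^T *m grad a p
     - (grad b x)^T *m grad psi p)
    ((R2 + R1 - 2) *: ((grad a p)^T *m grad b x) - (grad psi p)^T *m grad b x
     - (grad a p)^T *m grad phi x)
    (ricci g2 p + hessian g2 psi p - R1 *: hessian g2 a p
     - n1%:R *: ((grad a p)^T *m grad a p)
     - (al p ^- 2 * be x ^+ 2
        * \tr (invmx (g1 x) *m drift_hessian g1 b phi R2 x)) *: g2 p).
Proof.
have wg := warped_metric_row.
have wg' := warped_metricC wg.
have chiE' q w : chi (row_mx w q) =
    (psi q + (n1%:R - R1) * log al q) + (phi w + (n2%:R - R2) * log be w).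
  by rewrite addrC chiE.
apply/matrixP => i j.
case: (split_ordP i) => i' ->; case: (split_ordP j) => j' ->.
- by rewrite block_mxEul (ricci_hessian11 wg phiU psiU chiE Ux Up).
- by rewrite block_mxEur (ricci_hessian12 wg phiU psiU chiE Ux Up).
- by rewrite block_mxEdl (ricci_hessian12 wg' psiU phiU chiE' Up Ux).
- by rewrite block_mxEdr (ricci_hessian11 wg' psiU phiU chiE' Up Ux).
Qed.

Lemma grad_row :
  grad chi (row_mx x p) =
  row_mx (grad phi x + (n2%:R - R2) *: grad b x)
         (grad psi p + (n1%:R - R1) *: grad a p).
Proof.
have wg := warped_metric_row.
have C2a := C2_log (local_open g2U) alU.
have C2b := C2_log (local_open g1U) beU.
apply/rowP => i; case: (split_ordP i) => i' ->.
  rewrite row_mxEl !mxE.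
  rewrite (partial1_split wg chiE (differentiable_affine _ phiU C2b) _ _ Ux).
  by rewrite (partial_affine _ phiU C2b).
rewrite row_mxEr !mxE.
rewrite (partial2_split wg chiE (differentiable_affine _ psiU C2a) _ _ Up).
by rewrite (partial_affine _ psiU C2a).
Qed.

(** The hypothesis bounds [r] times the Hessian, so the form is multiplied by [r]; it is then at
    most (eta + r^2 + r) times a sum of two squares. *)
Lemma drift_hessian_le0 n (U : set 'rV[R]_n) h f f' u (r eta : R) :
  local_metric U h -> U u -> 0 < r -> r ^+ 2 + r <= - eta ->
  (forall v, r * quad (hessian h f u) v <=
     eta * (grad f' u *m v^T) 0 0 ^+ 2 + eta * (grad f u *m v^T) 0 0 ^+ 2) ->
  \tr (invmx (h u) *m drift_hessian h f f' r u) <= 0.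
Proof.
move=> hU Uu r0 reta H; apply: mxtrace_inv_posdef_le0.
- exact: local_sym hU _ Uu.
- exact: local_posdef hU _ Uu.
move=> v; rewrite -(pmulr_rle0 _ r0) /drift_hessian !quadD quadN quadZ !quad_outer.
move: (H v); move: (quad _ v) (_ 0 0) (_ 0 0) => q A Q hq.
(* This square absorbs the cross term [- r * A * Q] coming from da dPsi. *)
have AQ : 0 <= r * (A + Q) ^+ 2 by rewrite mulr_ge0 ?sqr_ge0// ltW.
have e : (r ^+ 2 + r) * (Q ^+ 2 + A ^+ 2) <= - eta * (Q ^+ 2 + A ^+ 2).
  by rewrite ler_wpM2r// addr_ge0 ?sqr_ge0.
have rQ : 0 <= r * Q ^+ 2 by rewrite mulr_ge0 ?sqr_ge0// ltW.
have rA : 0 <= r * A ^+ 2 by rewrite mulr_ge0 ?sqr_ge0// ltW.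
have r2Q : 0 <= r ^+ 2 * Q ^+ 2 by rewrite mulr_ge0 ?sqr_ge0.
rewrite sqrrD in AQ; lra.
Qed.

(** The Bakry-Emery bounds of the factors, solved for Ricci plus Hessian, supply the positive
    squares divided by N_i - n_i in the cross-term hypothesis. The other terms there come from the
    Hessian bounds, the blocks of the product and d chi. *)
Lemma bakry_emery_warped_ge (N1 N2 eta k1 k2 k : R) :
  0 < R1 -> 0 < R2 ->
  R1 ^+ 2 + R1 <= - eta -> R2 ^+ 2 + R2 <= - eta ->
  (forall P b Q a : R,
    0 <= (N1 - n1%:R)^-1 * P ^+ 2 + (N2 - n2%:R)^-1 * Q ^+ 2
      - eta * (P ^+ 2 + b ^+ 2)
      - eta * (Q ^+ 2 + a ^+ 2) - n2%:R * b ^+ 2 - n1%:R * a ^+ 2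
      + 2 * ((R1 + R2 - 2) * (b * a) - P * a - b * Q)
      - (N1 - n1%:R + (N2 - n2%:R))^-1 *
        (P + (n2%:R - R2) * b + (Q + (n1%:R - R1) * a)) ^+ 2) ->
  (forall v, k1 * quad (g1 x) v <= quad (bakry_emery N1 g1 phi x) v) ->
  (forall v, k2 * quad (g2 p) v <= quad (bakry_emery N2 g2 psi p) v) ->
  (forall v, R2 * quad (hessian g1 b x) v <=
     eta * (grad phi x *m v^T) 0 0 ^+ 2 + eta * (grad b x *m v^T) 0 0 ^+ 2) ->
  (forall v, R1 * quad (hessian g2 a p) v <=
     eta * (grad psi p *m v^T) 0 0 ^+ 2 + eta * (grad a p *m v^T) 0 0 ^+ 2) ->
  k <= al p ^- 2 * k1 -> k <= be x ^- 2 * k2 ->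
  forall v, k * quad (g (row_mx x p)) v <=
    quad (bakry_emery (N1 + N2) g chi (row_mx x p)) v.
Proof.
move=> R1_gt0 R2_gt0 eta1 eta2 cross ric1 ric2 hb ha kk1 kk2 v.
rewrite -(hsubmxK v); move: (lsubmx v) (rsubmx v) => X V {v}.
have t2 := drift_hessian_le0 g2U Up R1_gt0 eta1 ha.
have t1 := drift_hessian_le0 g1U Ux R2_gt0 eta2 hb.
have gradE : (grad chi (row_mx x p) *m (row_mx X V)^T) 0 0 =
    (grad phi x *m X^T) 0 0 + (n2%:R - R2) * (grad b x *m X^T) 0 0
    + ((grad psi p *m V^T) 0 0 + (n1%:R - R1) * (grad a p *m V^T) 0 0).
  rewrite grad_row tr_row_mx mul_row_col !mulmxDl -!scalemxAl.
  rewrite [LHS]mxE [X in X + _]mxE [X in _ + X + _]mxE [X in _ + X]mxE.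
  by rewrite [X in _ + (_ + X)]mxE.
rewrite /bakry_emery ricci_hessian_block row_mxKl row_mxKr.
rewrite quadD quadN quadZ quad_outer gradE !quad_block !mulmx0 !mul0mx !mul_outer_comb.
have z0 : (0 : 'M[R]_1) 0 0 = 0 by rewrite mxE.
rewrite !z0 !addr0.
move: (ric1 X) (ric2 V) (hb X) (ha V).
rewrite /bakry_emery !quadD !quadN !quadZ !quad_outer.
have quad_ge0 m (A : 'M[R]_m) w : posdef A -> 0 <= quad A w.
  by move=> pA; have [->|/pA/ltW//] := eqVneq w 0; rewrite /quad !mul0mx mxE.
have q1_ge0 := quad_ge0 _ _ X (local_posdef g1U Ux).
have q2_ge0 := quad_ge0 _ _ V (local_posdef g2U Up).
have a2_gt0 : 0 < al p ^+ 2 by rewrite exprn_gt0// (warping_gt0 alU).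
have b2_gt0 : 0 < be x ^+ 2 by rewrite exprn_gt0// (warping_gt0 beU).
(* On the first block the product metric is [al p ^+ 2] times [g1], so the bound on [k] is put in
   multiplied form. *)
have {}kk1 : k * al p ^+ 2 <= k1 by rewrite -ler_pdivlMr// mulrC.
have {}kk2 : k * be x ^+ 2 <= k2 by rewrite -ler_pdivlMr// mulrC.
have {}t1 : al p ^- 2 * be x ^+ 2
    * \tr (invmx (g1 x) *m drift_hessian g1 b phi R2 x) * quad (g2 p) V <= 0.
  by rewrite mulr_le0_ge0// mulr_ge0_le0// mulr_ge0 ?invr_ge0 ?ltW.
have {}t2 : be x ^- 2 * al p ^+ 2
    * \tr (invmx (g2 p) *m drift_hessian g2 a psi R1 p) * quad (g1 x) X <= 0.
  by rewrite mulr_le0_ge0// mulr_ge0_le0// mulr_ge0 ?invr_ge0 ?ltW.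
have NE : N1 + N2 - (n1 + n2)%:R = N1 - n1%:R + (N2 - n2%:R) by rewrite natrD; ring.
rewrite NE {NE}.
have := cross ((grad phi x *m X^T) 0 0) ((grad b x *m X^T) 0 0)
  ((grad psi p *m V^T) 0 0) ((grad a p *m V^T) 0 0).
move: t1 t2.
move: (\tr (invmx (g1 x) *m _)) (\tr (invmx (g2 p) *m _)) => T1 T2.
have := ler_wpM2r q1_ge0 kk1; have := ler_wpM2r q2_ge0 kk2.
move: (quad (ricci g1 x) X) (quad (hessian g1 phi x) X) (quad (hessian g1 b x) X)
  => ric1X hphi hbX.
move: (quad (ricci g2 p) V) (quad (hessian g2 psi p) V) (quad (hessian g2 a p) V)
  => ric2V hpsi haV.
move: ((grad phi x *m X^T) 0 0) ((grad b x *m X^T) 0 0)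
  ((grad psi p *m V^T) 0 0) ((grad a p *m V^T) 0 0) => P B Q A.
move: (quad (g1 x) X) (quad (g2 p) V) => q1 q2.
move: ((N1 - n1%:R + (N2 - n2%:R))^-1) => D.
move: ((N1 - n1%:R)^-1) ((N2 - n2%:R)^-1) => D1 D2.
move: (al p ^+ 2) (be x ^+ 2) => al2 be2.
move: (n1%:R) (n2%:R) => m1 m2.

(* With all tensors generalized to scalars, the goal is a sum of the bounds in context, linear in
   their monomials. *)
move=> *; lra.
Qed.

End WarpedCurvatureBound.

(** * Charts of a weighted manifold *)

Lemma smooth_on_C2 (R : realType) n (U : set 'rV[R]_n) f : smooth_on U f -> C2_on U f.
Proof.
move=> sf u Uu; split; first exact: (sf [::] u Uu).
by move=> k v; apply: diff_derivable; exact: (sf [:: k] u Uu).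
Qed.

Lemma local_warping_chart (R : realType) n (M : wmfd R n) (f : M -> R)
    (c : Defs.index M) :
  smooth_fun f -> (forall x, 0 < f x) ->
  local_warping (cod (atlas c)) (f \o param (atlas c)).
Proof.
move=> sf f0; split=> [u|u Uu|u k Uu]; first exact: f0.
  exact: (sf c [::] u Uu).
exact: (sf c [:: k] u Uu).
Qed.

Lemma local_metric_chart (R : realType) n (M : wmfd R n) (c : Defs.index M) :
  is_weighted_riemannian_manifold M -> local_metric (cod (atlas c)) (metric c).
Proof.
case=> -[_ _ chM _ _] [sm sym pos _] _ _; split.
- by have [] := chM c.
- by move=> u i j Uu; exact: (sm c i j [::] u Uu).
- exact: sym.
- by move=> u Uu v; exact: pos.
Qed.

Lemma cod_coord (R : realType) n (M : wmfd R n) (c : Defs.index M) x :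
  dom (atlas c) x -> cod (atlas c) (Defs.coord (atlas c) x).
Proof. by move=> cx; exists x. Qed.

(** Both sides are homogeneous of degree two in the vector, so a nonzero [v] is normalised to unit
    length; at [v = 0] both sides vanish. *)
Lemma unit_tangent_quad (R : realType) n (M : wmfd R n) (c : Defs.index M) x
    (f h : M -> R) (r eta : R) :
  is_weighted_riemannian_manifold M -> dom (atlas c) x ->
  differentiable (f \o param (atlas c)) (Defs.coord (atlas c) x) ->
  differentiable (h \o param (atlas c)) (Defs.coord (atlas c) x) ->
  (forall v, unit_tangent c x v ->
     r * hessian_at c h x v
     <= eta * deriv_at c f x v ^+ 2 + eta * deriv_at c h x v ^+ 2) ->
  forall v,
    r * quad (hessian (metric c) (h \o param (atlas c)) (Defs.coord (atlas c) x)) v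
    <= eta * (grad (f \o param (atlas c)) (Defs.coord (atlas c) x) *m v^T) 0 0 ^+ 2
    + eta * (grad (h \o param (atlas c)) (Defs.coord (atlas c) x) *m v^T) 0 0 ^+ 2.
Proof.
move=> MR cx df dh H v; have gM := local_metric_chart c MR.
have [->|v0] := eqVneq v 0.
  by rewrite trmx0 !mulmx0 /quad !mul0mx !mxE !expr0n/= !mulr0 addr0.
have s_gt0 := local_posdef gM (cod_coord cx) v0.
set s := quad _ v in s_gt0; pose t := Num.sqrt s.
have t_gt0 : 0 < t by rewrite sqrtr_gt0.
have t2 : t ^+ 2 = s by rewrite sqr_sqrtr// ltW.
have /H : unit_tangent c x (t^-1 *: v).
  by rewrite /unit_tangent/= /metric_at quad_scale exprVn t2 mulVf// lt0r_neq0.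
have dZ w : (w *m (t^-1 *: v)^T) 0 0 = t^-1 * (w *m v^T) 0 0.
  by rewrite linearZ/= -scalemxAr mxE.
rewrite /hessian_at /deriv_at !deriveE_grad// quad_scale !dZ !exprMn.
rewrite mulrCA [eta * _]mulrCA [X in _ + X]mulrCA -mulrDr.
by rewrite ler_pM2l// exprn_gt0// invr_gt0.
Qed.

Theorem corollary1p10 (R : realType) (n1 n2 : nat) (N1 N2 R1 R2 K1 K2 : R) :
  (0 < n1)%N -> (0 < n2)%N -> n1%:R < N1 -> n2%:R < N2 -> 0 < R1 -> 0 < R2 ->
  exists eta : R,
  forall (B : wmfd R n1) (F : wmfd R n2) (alpha : F -> R) (beta : B -> R),
  is_weighted_riemannian_manifold B -> is_weighted_riemannian_manifold F ->
  smooth_fun alpha -> (forall p, 0 < alpha p) ->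
  smooth_fun beta -> (forall x, 0 < beta x) ->
  let a := fun p => ln (alpha p) in
  let b := fun x => ln (beta x) in
  forall (x : B) (p : F) (KB KF : R),
  ric_ge N1 ((n1%:R - 1) * KB) x ->
  ric_ge N2 ((n2%:R - 1) * KF) p ->
  (forall c, dom (atlas c) x -> forall X, unit_tangent c x X ->
     R2 * hessian_at c b x X
     <= eta * deriv_at c (potential B) x X ^+ 2 + eta * deriv_at c b x X ^+ 2) ->
  (forall d, dom (atlas d) p -> forall V, unit_tangent d p V ->
     R1 * hessian_at d a p V
     <= eta * deriv_at d (potential F) p V ^+ 2 + eta * deriv_at d a p V ^+ 2) ->
  ric_ge (M := doubly_warped_product R1 R2 alpha beta) (N1 + N2)
    (Num.min ((n1%:R - 1) * alpha p ^- 2 * KB) ((n2%:R - 1) * beta x ^- 2 * KF))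
    (x, p).
Proof.
move=> n1_gt0 n2_gt0 N1_gt N2_gt R1_gt0 R2_gt0.
(* The constant is fixed from dimensions, exponents and N_i, before any manifold is introduced. *)
have [] := @cross_terms_bound R n1%:R n2%:R R1 R2 (N1 - n1%:R) (N2 - n2%:R);
  rewrite ?subr_gt0 ?ler0n ?ltW//.
move=> eta [eta1 eta2 cross]; exists eta.
move=> B F alpha beta BR FR sal al0 sbe be0 a b x p KB KF ricB ricF hb ha.
move=> [c d] [/= cx dp] v.
have g1U := local_metric_chart c BR.
have g2U := local_metric_chart d FR.
have alU := local_warping_chart d sal al0.
have beU := local_warping_chart c sbe be0.
have [_ _ _ /(_ c)/smooth_on_C2 phiU] := BR.
have [_ _ _ /(_ d)/smooth_on_C2 psiU] := FR.
have Ux := cod_coord cx; have Up := cod_coord dp.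
have [dphi _] := phiU _ Ux; have [dpsi _] := psiU _ Up.
have [_ _ chB _ _] : is_smooth_manifold B by case: BR.
have [_ _ chF _ _] : is_smooth_manifold F by case: FR.
have [_ _ pcB _ _] := chB c; have [_ _ pcF _ _] := chF d.
(* In a product chart the weight splits into a function on B plus a function on F, the shape
   required by the Hessian formulas. *)
have chiE w q : (potential (doubly_warped_product R1 R2 alpha beta)
     \o param (prod_chart (atlas c) (atlas d))) (row_mx w q) =
    ((potential B \o param (atlas c)) w
     + (n2%:R - R2) * log (beta \o param (atlas c)) w)
    + ((potential F \o param (atlas d)) q
       + (n1%:R - R1) * log (alpha \o param (atlas d)) q).
  by rewrite /= row_mxKl row_mxKr /log/=; ring.
apply: (bakry_emery_warped_ge g1U g2U alU beU phiU psiU chiE Ux Up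
  R1_gt0 R2_gt0 eta1 eta2 cross (ricB c cx) (ricF d dp)).
- apply: (unit_tangent_quad BR cx dphi _ (hb c cx)).
  exact: (differentiable_log beU).
- apply: (unit_tangent_quad FR dp dpsi _ (ha d dp)).
  exact: (differentiable_log alU).
(* [pcF] identifies [param] of the coordinates of [p] with [p], so the local warping value is
   [alpha p]; the minimum is below its first entry. *)
- by rewrite /= pcF// mulrA [_^-1 * _]mulrC ge_min lexx.
- by rewrite /= pcB// mulrA [_^-1 * _]mulrC ge_min lexx orbT.
Qed.
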